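(* Let $K$ be a field and let $\mathcal{G}$ be an ultragraph without sinks. Then $L_K(\mathcal{G})$, with its canonical $\mathbb{Z}$-grading, is a graded von Neumann regular ring. In particular: (1) any finitely generated right (left) graded ideal of $L_K(\mathcal{G})$ is generated by one homogeneous idempotent; (2) any graded right (left) ideal of $L_K(\mathcal{G})$ is idempotent; (3) any graded ideal of $L_K(\mathcal{G})$ is graded semi-prime; (4) any graded right (left) $L_K(\mathcal{G})$-module is flat; (5) $J(L_K(\mathcal{G}))=J^{\mathrm{gr}}(L_K(\mathcal{G}))=0$.
   Context: An ultragraph $\mathcal{G}=(G^0,\mathcal{G}^1,r,s)$ consists of a countable set $G^0$ of vertices, a countable set $\mathcal{G}^1$ of edges, and maps $s:\mathcal{G}^1\to G^0$, $r:\mathcal{G}^1\to\mathcal{P}(G^0)\setminus\{\varnothing\}$. A vertex $v$ is a sink if $s^{-1}(v)=\varnothing$, and regular if $0<|s^{-1}(v)|<\infty$. $\mathcal{G}^0$ is the smallest subset of $\mathcal{P}(G^0)$ containing all $\{v\}$ and all $r(e)$ and closed under finite unions and finite intersections. A finite path is either an element of $\mathcal{G}^0$ (length $0$) or a sequence $\alpha=e_1\cdots e_n$ of edges with $s(e_{i+1})\in r(e_i)$ (length $|\alpha|=n$); $\mathcal{G}^*$ is the set of finite paths. $L_K(\mathcal{G})$ is the $K$-algebra generated by $\{s_e,s_e^*: e\in\mathcal{G}^1\}\cup\{p_A: A\in\mathcal{G}^0\}$ subject to, for all $A,B\in\mathcal{G}^0$, $e,f\in\mathcal{G}^1$: (1)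 $p_\varnothing=0$, $p_Ap_B=p_{A\cap B}$, $p_{A\cup B}=p_A+p_B-p_{A\cap B}$; (2) $p_{s(e)}s_e=s_e=s_ep_{r(e)}$ and $p_{r(e)}s_e^*=s_e^*=s_e^*p_{s(e)}$; (3) $s_e^*s_f=\delta_{e,f}p_{r(e)}$; (4) $p_v=\sum_{s(e)=v}s_es_e^*$ for every regular vertex $v$ (with $p_v:=p_{\{v\}}$). Put $s_A:=s_A^*:=p_A$ for $A\in\mathcal G^0$, and $s_\alpha=s_{e_1}\cdots s_{e_n}$, $s_\alpha^*=s_{e_n}^*\cdots s_{e_1}^*$. The canonical $\mathbb{Z}$-grading is $L_K(\mathcal{G})_n=\mathrm{span}_K\{s_\alpha p_A s_\beta^*: \alpha,\beta\in\mathcal{G}^*, A\in\mathcal{G}^0, |\alpha|-|\beta|=n\}$. The ring need not have a unit. A graded ring $A$ is graded von Neumann regular if $x\in xAx$ for every homogeneous $x\in A$. A graded ideal $P$ of $A$ is graded semi-prime if for every graded ideal $I$ of $A$ and $n\in\mathbb{N}$, $I^n\subseteq P$ implies $I\subseteq P$. $J(A)$ is the Jacobson radical and $J^{\mathrm{gr}}(A)$ the graded Jacobson radical of $A$. *)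

(* Defs.v *)
From HB Require Import structures.
From mathcomp Require Import all_boot all_order all_algebra.
From mathcomp Require Import boolp classical_sets.
From mathcomp.multinomials Require Import freeg.

Set Implicit Arguments.
Unset Strict Implicit.
Unset Printing Implicit Defensive.

Import Order.TTheory GRing.Theory Num.Theory.
Local Open Scope classical_set_scope.
Local Open Scope ring_scope.
Local Open Scope quotient_scope.

(** * Rings and algebras without unit *)

HB.mixin Record Zmodule_isNuRing A of GRing.Zmodule A := {
  numul : A -> A -> A;
  numulA : associative numul;
  numulDl : left_distributive numul +%R;
  numulDr : right_distributive numul +%R
}.

#[short(type="nuRingType")]
HB.structure Definition NuRing := { A of Zmodule_isNuRing A & GRing.Zmodule A }.

Notation "x ** y" := (numul x y) (at level 40, left associativity) : ring_scope.

HB.mixin Record NuRing_isNuAlgebra (K : fieldType) A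
    of NuRing A & GRing.Lmodule K A := {
  nuscalerAl : forall (k : K) (x y : A), k *: (x ** y) = (k *: x) ** y;
  nuscalerAr : forall (k : K) (x y : A), k *: (x ** y) = x ** (k *: y)
}.

#[short(type="nuAlgType")]
HB.structure Definition NuAlgebra (K : fieldType) :=
  { A of NuRing A & GRing.Lmodule K A & NuRing_isNuAlgebra K A }.

(** * Non-unital algebras given by generators and relations *)

Inductive nuterm (K : fieldType) (X : Type) : Type :=
| TGen of X
| TZero
| TOpp of nuterm K X
| TAdd of nuterm K X & nuterm K X
| TScale of K & nuterm K X
| TMul of nuterm K X & nuterm K X.

Arguments TGen {K X}.
Arguments TZero {K X}.
Arguments TOpp {K X}.
Arguments TAdd {K X}.
Arguments TScale {K X}.
Arguments TMul {K X}.

HB.instance Definition _ (K : fieldType) (X : Type) := gen_eqMixin (nuterm K X).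
HB.instance Definition _ (K : fieldType) (X : Type) :=
  gen_choiceMixin (nuterm K X).

(* The least congruence that contains [R] and for which the quotient is an
   associative K-algebra. *)
Inductive nucong (K : fieldType) (X : Type)
    (R : nuterm K X -> nuterm K X -> Prop) : nuterm K X -> nuterm K X -> Prop :=
| NCrel t u : R t u -> nucong R t u
| NCrefl t : nucong R t t
| NCsym t u : nucong R t u -> nucong R u t
| NCtrans t u v : nucong R t u -> nucong R u v -> nucong R t v
| NCopp t t' : nucong R t t' -> nucong R (TOpp t) (TOpp t')
| NCadd t t' u u' :
    nucong R t t' -> nucong R u u' -> nucong R (TAdd t u) (TAdd t' u')
| NCscale k t t' : nucong R t t' -> nucong R (TScale k t) (TScale k t')
| NCmul t t' u u' :
    nucong R t t' -> nucong R u u' -> nucong R (TMul t u) (TMul t' u')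
| NCaddA t u v : nucong R (TAdd t (TAdd u v)) (TAdd (TAdd t u) v)
| NCaddC t u : nucong R (TAdd t u) (TAdd u t)
| NCadd0 t : nucong R (TAdd TZero t) t
| NCaddN t : nucong R (TAdd (TOpp t) t) TZero
| NCscaleA k l t : nucong R (TScale k (TScale l t)) (TScale (k * l) t)
| NCscale1 t : nucong R (TScale 1 t) t
| NCscaleDr k t u :
    nucong R (TScale k (TAdd t u)) (TAdd (TScale k t) (TScale k u))
| NCscaleDl k l t :
    nucong R (TScale (k + l) t) (TAdd (TScale k t) (TScale l t))
| NCmulA t u v : nucong R (TMul t (TMul u v)) (TMul (TMul t u) v)
| NCmulDl t u v : nucong R (TMul (TAdd t u) v) (TAdd (TMul t v) (TMul u v))
| NCmulDr t u v : nucong R (TMul t (TAdd u v)) (TAdd (TMul t u) (TMul t v))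
| NCscaleMl k t u : nucong R (TScale k (TMul t u)) (TMul (TScale k t) u)
| NCscaleMr k t u : nucong R (TScale k (TMul t u)) (TMul t (TScale k u)).

Section Presented.
Variables (K : fieldType) (X : Type) (R : nuterm K X -> nuterm K X -> Prop).

Definition nucongb (t u : nuterm K X) : bool := `[< nucong R t u >].

Fact nucongb_equiv : equiv_class_of nucongb.
Proof.
split.
- by move=> t; apply/asboolP/NCrefl.
- by move=> t u; apply/asboolP/asboolP; apply: NCsym.
- move=> t u v /asboolP ut /asboolP tv; apply/asboolP.
  exact: NCtrans ut tv.
Qed.

Canonical nucong_equiv : equiv_rel (nuterm K X) := EquivRelPack nucongb_equiv.

Definition presented : Type := {eq_quot nucong_equiv}.

HB.instance Definition _ := Choice.on presented.

Definition pclass (t : nuterm K X) : presented := \pi_{eq_quot nucong_equiv} t.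
Definition prep (x : presented) : nuterm K X :=
  repr (x : {eq_quot nucong_equiv}).

Fact pclassP t u : pclass t = pclass u <-> nucong R t u.
Proof.
split=> [/eqmodP /asboolP //|tu]; apply/eqmodP; exact/asboolP.
Qed.

Fact prepK x : pclass (prep x) = x.
Proof. exact: reprK. Qed.

Fact pclassK t : nucong R (prep (pclass t)) t.
Proof. by apply/pclassP; rewrite prepK. Qed.

Definition pzero : presented := pclass TZero.
Definition popp (x : presented) := pclass (TOpp (prep x)).
Definition padd (x y : presented) := pclass (TAdd (prep x) (prep y)).
Definition pscale (k : K) (x : presented) := pclass (TScale k (prep x)).
Definition pmul (x y : presented) := pclass (TMul (prep x) (prep y)).

Fact poppE t : popp (pclass t) = pclass (TOpp t).
Proof. exact/pclassP/NCopp/pclassK. Qed.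
Fact paddE t u : padd (pclass t) (pclass u) = pclass (TAdd t u).
Proof. by apply/pclassP/NCadd; apply: pclassK. Qed.
Fact pscaleE k t : pscale k (pclass t) = pclass (TScale k t).
Proof. exact/pclassP/NCscale/pclassK. Qed.
Fact pmulE t u : pmul (pclass t) (pclass u) = pclass (TMul t u).
Proof. by apply/pclassP/NCmul; apply: pclassK. Qed.

Fact paddA : associative padd.
Proof.
move=> x y z; rewrite -(prepK x) -(prepK y) -(prepK z) !paddE.
exact/pclassP/NCaddA.
Qed.
Fact paddC : commutative padd.
Proof.
by move=> x y; rewrite -(prepK x) -(prepK y) !paddE; apply/pclassP/NCaddC.
Qed.
Fact padd0 : left_id pzero padd.
Proof. by move=> x; rewrite -(prepK x) paddE; apply/pclassP/NCadd0. Qed.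
Fact paddN : left_inverse pzero popp padd.
Proof. by move=> x; rewrite -(prepK x) poppE paddE; apply/pclassP/NCaddN. Qed.

HB.instance Definition _ :=
  GRing.isZmodule.Build presented paddA paddC padd0 paddN.

Fact pscaleA k l x : pscale k (pscale l x) = pscale (k * l) x.
Proof. by rewrite -(prepK x) !pscaleE; apply/pclassP/NCscaleA. Qed.
Fact pscale1 : left_id 1 pscale.
Proof. by move=> x; rewrite -(prepK x) pscaleE; apply/pclassP/NCscale1. Qed.
Fact pscaleDr : right_distributive pscale +%R.
Proof.
move=> k x y; rewrite -(prepK x) -(prepK y) /GRing.add /=.
by rewrite !(pscaleE, paddE); apply/pclassP/NCscaleDr.
Qed.
Fact pscaleDl x : {morph pscale^~ x : k l / k + l >-> k + l}.
Proof.
move=> k l /=; rewrite -(prepK x) [in RHS]/GRing.add /=.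
by rewrite !(pscaleE, paddE); apply/pclassP/NCscaleDl.
Qed.

HB.instance Definition _ := GRing.Zmodule_isLmodule.Build K presented
  pscaleA pscale1 pscaleDr pscaleDl.

Fact pmulA : associative pmul.
Proof.
move=> x y z; rewrite -(prepK x) -(prepK y) -(prepK z) !pmulE.
exact/pclassP/NCmulA.
Qed.
Fact pmulDl : left_distributive pmul +%R.
Proof.
move=> x y z; rewrite -(prepK x) -(prepK y) -(prepK z) /GRing.add /=.
by rewrite !(paddE, pmulE); apply/pclassP/NCmulDl.
Qed.
Fact pmulDr : right_distributive pmul +%R.
Proof.
move=> x y z; rewrite -(prepK x) -(prepK y) -(prepK z) /GRing.add /=.
by rewrite !(paddE, pmulE); apply/pclassP/NCmulDr.
Qed.

HB.instance Definition _ :=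
  Zmodule_isNuRing.Build presented pmulA pmulDl pmulDr.

Fact pscalerAl (k : K) (x y : presented) : k *: (x ** y) = (k *: x) ** y.
Proof.
rewrite -(prepK x) -(prepK y) /GRing.scale /numul /= !(pscaleE, pmulE).
exact/pclassP/NCscaleMl.
Qed.
Fact pscalerAr (k : K) (x y : presented) : k *: (x ** y) = x ** (k *: y).
Proof.
rewrite -(prepK x) -(prepK y) /GRing.scale /numul /= !(pscaleE, pmulE).
exact/pclassP/NCscaleMr.
Qed.

HB.instance Definition _ :=
  NuRing_isNuAlgebra.Build K presented pscalerAl pscalerAr.

End Presented.

(** * Ultragraphs *)

Record ultragraph := Ultragraph {
  vertex : countType;
  edge : countType;
  erange : edge -> set vertex;
  esource : edge -> vertex;
  erange_neq0 : forall e, erange e !=set0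
}.

Definition no_sinks (G : ultragraph) : Prop :=
  forall v : vertex G, exists e : edge G, esource e = v.

(* The empty set (the empty union) is a member: the relation p_set0 = 0
   presupposes it. *)
Inductive gen_vset (G : ultragraph) : set (vertex G) -> Prop :=
| gen_vset0 : gen_vset set0
| gen_vset1 v : gen_vset [set v]
| gen_vset_range e : gen_vset (erange e)
| gen_vsetU A B : gen_vset A -> gen_vset B -> gen_vset (A `|` B)
| gen_vsetI A B : gen_vset A -> gen_vset B -> gen_vset (A `&` B).

Record gvset (G : ultragraph) := GVset {
  gvset_car :> set (vertex G);
  gvsetP : gen_vset gvset_car
}.

Section GVsetOps.
Variable G : ultragraph.
Definition gv0 : gvset G := GVset (gen_vset0 G).
Definition gv1 (v : vertex G) : gvset G := GVset (gen_vset1 v).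
Definition gvrange (e : edge G) : gvset G := GVset (gen_vset_range e).
Definition gvU (A B : gvset G) : gvset G :=
  GVset (gen_vsetU (gvsetP A) (gvsetP B)).
Definition gvI (A B : gvset G) : gvset G :=
  GVset (gen_vsetI (gvsetP A) (gvsetP B)).
End GVsetOps.

(* [e :: l] is the edge sequence of a path. *)
Fixpoint edge_chain (G : ultragraph) (e : edge G) (l : seq (edge G)) : Prop :=
  if l is f :: l' then erange e (esource f) /\ edge_chain f l' else True.

Inductive upath (G : ultragraph) : Type :=
| PSet of gvset G
| PEdges (e : edge G) (l : seq (edge G)) of edge_chain e l.

Definition plength (G : ultragraph) (a : upath G) : nat :=
  match a with PSet _ => 0 | PEdges _ l _ => (size l).+1 end.

(** * The Leavitt path algebra of an ultragraph *)

Inductive lpa_gen (G : ultragraph) : Type :=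
| GenS of edge G
| GenSstar of edge G
| GenP of gvset G.

Section LpaRelations.
Variables (K : fieldType) (G : ultragraph).

Local Notation S e := (TGen (GenS e) : nuterm K (lpa_gen G)).
Local Notation S' e := (TGen (GenSstar e) : nuterm K (lpa_gen G)).
Local Notation P A := (TGen (GenP A) : nuterm K (lpa_gen G)).

Inductive lpa_rel : nuterm K (lpa_gen G) -> nuterm K (lpa_gen G) -> Prop :=
| rel_p0 : lpa_rel (P (gv0 G)) TZero
| rel_pI A B : lpa_rel (TMul (P A) (P B)) (P (gvI A B))
| rel_pU A B :
    lpa_rel (P (gvU A B)) (TAdd (TAdd (P A) (P B)) (TOpp (P (gvI A B))))
| rel_source_s e : lpa_rel (TMul (P (gv1 (esource e))) (S e)) (S e)
| rel_s_range e : lpa_rel (TMul (S e) (P (gvrange e))) (S e)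
| rel_range_sstar e : lpa_rel (TMul (P (gvrange e)) (S' e)) (S' e)
| rel_sstar_source e : lpa_rel (TMul (S' e) (P (gv1 (esource e)))) (S' e)
| rel_sstar_s e : lpa_rel (TMul (S' e) (S e)) (P (gvrange e))
| rel_sstar_s_neq e f : e <> f -> lpa_rel (TMul (S' e) (S f)) TZero
  (* [v] is regular: [l] lists without repetition the finite nonempty set of
     edges with source [v]. *)
| rel_regular v (l : seq (edge G)) :
    l <> [::] -> uniq l -> (forall e, (e \in l) = (esource e == v)) ->
    lpa_rel (P (gv1 v)) (\big[TAdd/TZero]_(e <- l) TMul (S e) (S' e)).

Definition lpa : Type := presented lpa_rel.

HB.instance Definition _ := NuAlgebra.on lpa.

Definition lpa_s (e : edge G) : lpa := pclass lpa_rel (S e).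
Definition lpa_sstar (e : edge G) : lpa := pclass lpa_rel (S' e).
Definition lpa_p (A : gvset G) : lpa := pclass lpa_rel (P A).

Fixpoint s_edges (e : edge G) (l : seq (edge G)) : lpa :=
  if l is f :: l' then lpa_s e ** s_edges f l' else lpa_s e.

Fixpoint sstar_edges (e : edge G) (l : seq (edge G)) : lpa :=
  if l is f :: l' then sstar_edges f l' ** lpa_sstar e else lpa_sstar e.

Definition s_path (a : upath G) : lpa :=
  match a with PSet A => lpa_p A | PEdges e l _ => s_edges e l end.

Definition sstar_path (a : upath G) : lpa :=
  match a with PSet A => lpa_p A | PEdges e l _ => sstar_edges e l end.

Definition lpa_spanning (n : int) : set lpa :=
  [set x | exists a b : upath G, exists A : gvset G,
     (plength a)%:Z - (plength b)%:Z = n /\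
     x = s_path a ** lpa_p A ** sstar_path b].

Definition lpa_component (n : int) : set lpa :=
  [set x | exists l : seq (K * lpa),
     (forall c, c \in l -> lpa_spanning n c.2) /\
     x = \sum_(c <- l) c.1 *: c.2].

End LpaRelations.

(** * Gradings by the integers *)

Definition is_subgroup (V : zmodType) (U : set V) : Prop :=
  U 0 /\ forall x y, U x -> U y -> U (x - y).

Definition is_direct_sum (V : zmodType) (V_ : int -> set V) : Prop :=
  [/\ forall n, is_subgroup (V_ n),
      forall x : V, exists (s : seq int) (c : int -> V),
        (forall n, V_ n (c n)) /\ x = \sum_(n <- s) c n
    & forall (s : seq int) (c : int -> V),
        uniq s -> (forall n, V_ n (c n)) -> \sum_(n <- s) c n = 0 ->
        forall n, n \in s -> c n = 0].

(* U is the sum of the U :&: V_ n. *)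
Definition is_graded_subset (V : zmodType) (V_ : int -> set V) (U : set V) :
    Prop :=
  forall x, U x -> exists (s : seq int) (c : int -> V),
    (forall n, V_ n (c n) /\ U (c n)) /\ x = \sum_(n <- s) c n.

Section Graded.
Variables (A : nuRingType) (A_ : int -> set A).

Definition is_graded_ring : Prop :=
  is_direct_sum A_ /\
  forall (m n : int) (x y : A), A_ m x -> A_ n y -> A_ (m + n) (x ** y).

Definition homogeneous (x : A) : Prop := exists n, A_ n x.

Definition graded_von_neumann_regular : Prop :=
  is_graded_ring /\
  forall x, homogeneous x -> exists y : A, x = x ** y ** x.

Definition right_ideal (I : set A) : Prop :=
  is_subgroup I /\ forall x a, I x -> I (x ** a).
Definition left_ideal (I : set A) : Prop :=
  is_subgroup I /\ forall x a, I x -> I (a ** x).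

Definition graded_right_ideal (I : set A) : Prop :=
  right_ideal I /\ is_graded_subset A_ I.
Definition graded_left_ideal (I : set A) : Prop :=
  left_ideal I /\ is_graded_subset A_ I.
Definition graded_ideal (I : set A) : Prop :=
  [/\ right_ideal I, left_ideal I & is_graded_subset A_ I].

Definition right_ideal_gen (X : set A) : set A := smallest right_ideal X.
Definition left_ideal_gen (X : set A) : set A := smallest left_ideal X.

Definition idempotent_elt (e : A) : Prop := e ** e = e.

Definition ideal_mul (I J : set A) : set A :=
  [set x | exists l : seq (A * A),
     (forall p, p \in l -> I p.1 /\ J p.2) /\ x = \sum_(p <- l) p.1 ** p.2].

Definition idempotent_ideal (I : set A) : Prop := ideal_mul I I = I.

(* [ideal_expS I n] is the power of I with exponent n.+1; a ring without unit
   has no canonical power with exponent 0. *)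
Fixpoint ideal_expS (I : set A) (n : nat) : set A :=
  if n is m.+1 then ideal_mul (ideal_expS I m) I else I.

Definition graded_semiprime (P : set A) : Prop :=
  graded_ideal P /\
  forall (I : set A) (n : nat),
    graded_ideal I -> ideal_expS I n `<=` P -> I `<=` P.

End Graded.

(** * Modules over a ring without unit *)

Record rmodule (A : nuRingType) := RModule {
  rmod_car :> zmodType;
  ract : rmod_car -> A -> rmod_car;
  ractDl : forall x y a, ract (x + y) a = ract x a + ract y a;
  ractDr : forall x a b, ract x (a + b) = ract x a + ract x b;
  ractA : forall x a b, ract x (a ** b) = ract (ract x a) b
}.

Record lmodule (A : nuRingType) := LModule {
  lmod_car :> zmodType;
  lact : A -> lmod_car -> lmod_car;
  lactDl : forall a b x, lact (a + b) x = lact a x + lact b x;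
  lactDr : forall a x y, lact a (x + y) = lact a x + lact a y;
  lactA : forall a b x, lact (a ** b) x = lact a (lact b x)
}.

Section Modules.
Variable A : nuRingType.

Definition rmod_hom (M N : rmodule A) (f : M -> N) : Prop :=
  (forall x y, f (x + y) = f x + f y) /\
  forall x (a : A), f (ract x a) = ract (f x) a.
Definition lmod_hom (M N : lmodule A) (f : M -> N) : Prop :=
  (forall x y, f (x + y) = f x + f y) /\
  forall (a : A) x, f (lact a x) = lact a (f x).

Definition unital_rmodule (M : rmodule A) : Prop :=
  forall x : M, exists l : seq (M * A), x = \sum_(p <- l) ract p.1 p.2.
Definition unital_lmodule (M : lmodule A) : Prop :=
  forall x : M, exists l : seq (A * M), x = \sum_(p <- l) lact p.1 p.2.

(* The tensor product of M and N over A is the quotient of the free abelian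
   group on M * N by the subgroup [tensor_null]. *)
Section Tensor.
Variables (M : rmodule A) (N : lmodule A).

Definition pure_tensor (x : M) (y : N) : {freeg (M * N)%type / int} :=
  << (x, y) >>.

Inductive tensor_null : {freeg (M * N)%type / int} -> Prop :=
| tn_zero : tensor_null 0
| tn_sub t u : tensor_null t -> tensor_null u -> tensor_null (t - u)
| tn_addl x x' y : tensor_null
    (pure_tensor (x + x') y - (pure_tensor x y + pure_tensor x' y))
| tn_addr x y y' : tensor_null
    (pure_tensor x (y + y') - (pure_tensor x y + pure_tensor x y'))
| tn_balanced x a y : tensor_null
    (pure_tensor (ract x a) y - pure_tensor x (lact a y)).

End Tensor.

Definition tensor_map (M M' : rmodule A) (N N' : lmodule A)
    (f : M -> M') (g : N -> N') (t : {freeg (M * N)%type / int}) :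
    {freeg (M' * N')%type / int} :=
  fglift (fun p => pure_tensor (f p.1) (g p.2)) t.

(* Flatness over a ring with local units: tensoring preserves injectivity on
   the category of unital modules. If M itself is unital, this amounts to
   preserving injectivity on all modules, since M (x) N = M (x) AN. *)
Definition flat_rmodule (M : rmodule A) : Prop :=
  forall (N' N : lmodule A) (f : N' -> N),
    unital_lmodule N' -> unital_lmodule N -> lmod_hom f -> injective f ->
    forall t : {freeg (M * N')%type / int},
      tensor_null (tensor_map (id : M -> M) f t) -> tensor_null t.
Definition flat_lmodule (N : lmodule A) : Prop :=
  forall (M' M : rmodule A) (f : M' -> M),
    unital_rmodule M' -> unital_rmodule M -> rmod_hom f -> injective f ->
    forall t : {freeg (M' * N)%type / int},
      tensor_null (tensor_map f (id : N -> N) t) -> tensor_null t.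

Definition rsubmodule (M : rmodule A) (U : set M) : Prop :=
  is_subgroup U /\ forall x (a : A), U x -> U (ract x a).

Definition simple_rmodule (M : rmodule A) : Prop :=
  (exists (x : M) (a : A), ract x a <> 0) /\
  forall U : set M, rsubmodule U -> U = [set 0] \/ U = setT.

Variable A_ : int -> set A.

Definition is_rmodule_grading (M : rmodule A) (M_ : int -> set M) : Prop :=
  is_direct_sum M_ /\
  forall m n x a, M_ m x -> A_ n a -> M_ (m + n) (ract x a).
Definition is_lmodule_grading (M : lmodule A) (M_ : int -> set M) : Prop :=
  is_direct_sum M_ /\
  forall m n a x, A_ m a -> M_ n x -> M_ (m + n) (lact a x).

Definition graded_simple_rmodule (M : rmodule A) (M_ : int -> set M) : Prop :=
  [/\ is_rmodule_grading M_,
      exists (x : M) (a : A), ract x a <> 0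
    & forall U : set M, rsubmodule U -> is_graded_subset M_ U ->
        U = [set 0] \/ U = setT].

(* In a ring without unit, the (graded) Jacobson radical is the set of elements
   that annihilate every (graded) simple module. *)
Definition jacobson_radical : set A :=
  [set a | forall M : rmodule A, simple_rmodule M ->
     forall x : M, ract x a = 0].
Definition graded_jacobson_radical : set A :=
  [set a | forall (M : rmodule A) (M_ : int -> set M),
     graded_simple_rmodule M_ -> forall x : M, ract x a = 0].

End Modules.

Arguments jacobson_radical : clear implicits.

(* Main.v *)
Require Import Defs.
From HB Require Import structures.
From mathcomp Require Import all_boot all_order all_algebra.
From mathcomp Require Import boolp classical_sets.
From mathcomp.multinomials Require Import freeg.
From mathcomp Require Import zify.

(* Let V(m,k) be the span of the s_a p_B s_b^* with |a| <= m, |b| <= k and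
   |a| - |b| = m - k.  Then V(m,k) V(k,l) is contained in V(m,l), and
   s_e^* V(m+1,k), V(m,k+1) s_e are contained in V(m,k).  If x - xyx is von
   Neumann regular, so is x; using this, elements of V(m,k) are reduced, row by
   row and column by column, to single matrix entries s_e z s_f^* with z in
   V(m-1,k-1), and finally to V(0,0), which is commutative and spanned by
   idempotents.  The case m < k is the case k < m in the opposite algebra.  The
   sum of the homogeneous components is direct because the algebra acts on
   Z-indexed sequences by multiplication combined with the shift by the degree.

   The rest holds in every graded regular ring.  Finitely many homogeneous
   elements a_j admit homogeneous b_j with a_j (sum_i b_i a_i) = a_j, which
   gives (1) and, applied to columns of homogeneous relations, turns a finite
   set of relations in a graded module into a projection, hence flatness.  A
   nonzero graded two-sided ideal contains a nonzero homogeneous idempotent,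
   which acts nontrivially on some graded simple module, so J^gr = 0.  In a
   graded simple module the maximal submodules intersect in 0, so J is
   contained in J^gr. *)

Import Order.TTheory GRing.Theory Num.Theory.
Local Open Scope classical_set_scope.
Local Open Scope ring_scope.

Set Implicit Arguments.
Unset Strict Implicit.
Unset Printing Implicit Defensive.

(** At a vertex emitting infinitely many edges no finite sum of the s_e s_e^* equals p_v, so V(m,k)
    is not just a set of matrices over V(m-1,k-1): on the right there remain terms s_a p_B that do
    not end with an s_e^*. For a given x, a finite sum q = [range_sum] separates the matrix part x q
    from x(1-q), which equals t(1-q) with t in V(m-k,0). The second part gets its own quasi-inverse,
    and correcting x by it leaves an element fixed by q. Taking k <= m confines this obstruction to
    one side: once a last s_f^* has been stripped, every term begins with an edge. There is no unit,
    so x(1-q) is always written x - x q. Quasi-inverses are sought inside V(k,m), not merely in the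
    algebra, because each reduction feeds them back into products whose lengths must stay bounded.
    This also gives an element of degree n a quasi-inverse of degree -n, which the general theory of
    graded regular rings uses. *)

Section NuRingTheory.
Variable A : nuRingType.
Implicit Types x y z : A.

Lemma nu0r x : 0 ** x = 0.
Proof. by apply: (addrI (0 ** x)); rewrite -numulDl !addr0. Qed.
Lemma nur0 x : x ** 0 = 0.
Proof. by apply: (addrI (x ** 0)); rewrite -numulDr !addr0. Qed.
Lemma nuNr x y : (- x) ** y = - (x ** y).
Proof. by apply: (addrI (x ** y)); rewrite -numulDl !subrr nu0r. Qed.
Lemma nurN x y : x ** (- y) = - (x ** y).
Proof. by apply: (addrI (x ** y)); rewrite -numulDr !subrr nur0. Qed.
Lemma nuBl x y z : (x - y) ** z = x ** z - y ** z.
Proof. by rewrite numulDl nuNr. Qed.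
Lemma nuBr x y z : x ** (y - z) = x ** y - x ** z.
Proof. by rewrite numulDr nurN. Qed.
Lemma nu_suml I (r : seq I) (P : pred I) (F : I -> A) x :
  (\sum_(i <- r | P i) F i) ** x = \sum_(i <- r | P i) F i ** x.
Proof. exact: (big_morph (fun y => y ** x) (fun y z => numulDl y z x) (nu0r x)). Qed.
Lemma nu_sumr I (r : seq I) (P : pred I) (F : I -> A) x :
  x ** (\sum_(i <- r | P i) F i) = \sum_(i <- r | P i) x ** F i.
Proof. exact: (big_morph (fun y => x ** y) (fun y z => numulDr x y z) (nur0 x)). Qed.

End NuRingTheory.

Section SubgroupTheory.
Variables (V : zmodType) (U : set V).
Hypothesis hU : is_subgroup U.

Lemma subgroup0 : U 0. Proof. by case: hU. Qed.
Lemma subgroupB x y : U x -> U y -> U (x - y). Proof. by case: hU => _; apply. Qed.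
Lemma subgroupN x : U x -> U (- x).
Proof. by move=> Ux; rewrite -sub0r; apply: subgroupB; [exact: subgroup0|]. Qed.
Lemma subgroupD x y : U x -> U y -> U (x + y).
Proof. by move=> Ux Uy; rewrite -[y]opprK; apply: subgroupB => //; apply: subgroupN. Qed.
Lemma subgroup_sum (I : eqType) (r : seq I) (F : I -> V) :
  (forall i, i \in r -> U (F i)) -> U (\sum_(i <- r) F i).
Proof.
elim: r => [|i r IH] h; first by rewrite big_nil; exact: subgroup0.
rewrite big_cons; apply: subgroupD; first by apply: h; rewrite inE eqxx.
by apply: IH => j jr; apply: h; rewrite inE jr orbT.
Qed.
End SubgroupTheory.

(** * The opposite ring *)

Definition nuop (A : Type) : Type := A.

HB.instance Definition _ (A : zmodType) := GRing.Zmodule.copy (nuop A) A.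
HB.instance Definition _ (K : fieldType) (A : lmodType K) :=
  GRing.Lmodule.copy (nuop A) A.

Section OppositeRing.
Variable A : nuRingType.

Definition opmul (x y : nuop A) : nuop A := (y : A) ** (x : A).
Fact opmulA : associative opmul.
Proof. by move=> x y z; rewrite /opmul numulA. Qed.
Fact opmulDl : left_distributive opmul +%R.
Proof. by move=> x y z; exact: (@numulDr A). Qed.
Fact opmulDr : right_distributive opmul +%R.
Proof. by move=> x y z; exact: (@numulDl A). Qed.
HB.instance Definition _ :=
  Zmodule_isNuRing.Build (nuop A) opmulA opmulDl opmulDr.
End OppositeRing.

Lemma nuopE (A : nuRingType) (x y : A) : (x : nuop A) ** (y : nuop A) = y ** x.
Proof. by []. Qed.

Section OppositeAlgebra.
Variables (K : fieldType) (A : nuAlgType K).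
Fact opscalerAl (k : K) (x y : nuop A) : k *: (x ** y) = (k *: x : nuop A) ** y.
Proof. exact: (@nuscalerAr K A k y x). Qed.
Fact opscalerAr (k : K) (x y : nuop A) : k *: (x ** y) = x ** (k *: y : nuop A).
Proof. exact: (@nuscalerAl K A k y x). Qed.
HB.instance Definition _ :=
  NuRing_isNuAlgebra.Build K (nuop A) opscalerAl opscalerAr.
End OppositeAlgebra.

(** * Von Neumann regular elements *)

Definition regular_in (A : nuRingType) (Y : set A) (x : A) : Prop :=
  exists2 y, Y y & x = x ** y ** x.

Lemma regular_op (A : nuRingType) (Y : set A) (x : A) :
  regular_in (A := nuop A) Y x <-> regular_in Y x.
Proof.
by split=> -[y Yy h]; exists y; rewrite // [LHS]h; [exact: numulA | rewrite -numulA].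
Qed.

Section RegularReduction.
Variables (A : nuRingType) (X Y : set A).
Hypotheses (hX : is_subgroup X) (hY : is_subgroup Y).
Hypothesis XYX : forall x y z, X x -> Y y -> X z -> X (x ** y ** z).
Hypothesis YXY : forall x y z, Y x -> X y -> Y z -> Y (x ** y ** z).

(** With a formal unit the witness is y + (1-yx)z(1-xy): between two copies of x it gives xyx + dzd
    = xyx + d = x. The closure hypothesis [YXY] keeps it in [Y]. *)
Lemma regular_reduce x y : X x -> Y y ->
  regular_in Y (x - x ** y ** x) -> regular_in Y x.
Proof.
move=> Xx Yy; set d := x - _ => -[z Yz dE].
pose w := z - y ** x ** z.
have xw : x ** w = d ** z by rewrite /w nuBr /d nuBl !numulA.
have Yw : Y w by apply: subgroupB => //; apply: YXY.
exists (y + (w - w ** x ** y)).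
  by apply: subgroupD => //; apply: subgroupB => //; apply: YXY.
rewrite numulDr numulDl nuBr !numulA xw nuBl.
have -> : d ** z ** x - d ** z ** x ** y ** x = d ** z ** d.
  by transitivity (d ** z ** (x - x ** y ** x)); rewrite // nuBr !numulA.
by rewrite -dE /d addrC subrK.
Qed.

(** Elimination along a row: a quasi-inverse y of x q_i gives the candidate q_i y for x. The
    remainder x - x(q_i y)x is killed by q_i on the right, hence fixed by the sum of the remaining
    idempotents. *)
Lemma regular_row (I : eqType) (q : I -> A) (F : seq I) :
  (forall i, q i ** q i = q i) ->
  (forall i x, X x -> X (x ** q i)) -> (forall i y, Y y -> Y (q i ** y)) ->
  (forall i x, i \in F -> X x -> x = x ** q i -> regular_in Y x) ->
  forall x, X x -> x = x ** (\sum_(i <- F) q i) -> regular_in Y x.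
Proof.
move=> qq Xq Yq; elim: F => [|i F IH] h x Xx.
  rewrite big_nil nur0 => ->; exists 0; first exact: subgroup0.
  by rewrite nur0.
rewrite big_cons => xE.
have [|||y Yy x1E] := h i (x ** q i).
- by rewrite inE eqxx.
- exact: Xq.
- by rewrite -numulA qq.
have Yqy := Yq i _ Yy.
apply: (regular_reduce Xx Yqy).
set x' := x - _.
have x'q : x' ** q i = 0.
  by rewrite /x' nuBl !numulA -[x ** q i ** y ** x ** q i]numulA -x1E subrr.
have x'E : x' = x' ** (q i + \sum_(j <- F) q j).
  by rewrite {2}/x' nuBl -xE -numulA -xE.
apply: IH.
- by move=> j z jF; apply: h; rewrite inE jF orbT.
- by apply: subgroupB => //; apply: XYX.
- by rewrite {1}x'E numulDr x'q add0r.
Qed.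

End RegularReduction.

Section RegularColumn.
Variables (A : nuRingType) (X Y : set A).
Hypotheses (hX : is_subgroup X) (hY : is_subgroup Y).
Hypothesis XYX : forall x y z, X x -> Y y -> X z -> X (x ** y ** z).
Hypothesis YXY : forall x y z, Y x -> X y -> Y z -> Y (x ** y ** z).

Lemma regular_column (I : eqType) (q : I -> A) (F : seq I) :
  (forall i, q i ** q i = q i) ->
  (forall i x, X x -> X (q i ** x)) -> (forall i y, Y y -> Y (y ** q i)) ->
  (forall i x, i \in F -> X x -> x = q i ** x -> regular_in Y x) ->
  forall x, X x -> x = (\sum_(i <- F) q i) ** x -> regular_in Y x.
Proof.
move=> qq Xq Yq h x Xx xE; apply/regular_op.
apply: (@regular_row (nuop A) X Y _ _ _ _ I q F) => //.
- by move=> a b c; rewrite !nuopE numulA => *; apply: XYX.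
- by move=> a b c; rewrite !nuopE numulA => *; apply: YXY.
- by move=> i z iF Xz zE; apply/regular_op/(h i).
Qed.
End RegularColumn.

(** * Homogeneous elements of an algebra generated by a Leavitt family *)

Lemma gvset_eq (G : ultragraph) (A B : gvset G) :
  gvset_car A = gvset_car B -> A = B.
Proof.
by case: A B => A hA [B hB] /= AB; case: _ / AB hB => hB; rewrite (Prop_irrelevance hA hB).
Qed.

(** An abstract interface instead of [lpa] itself: passing to the opposite algebra exchanges [s] and
    [s'], so a one-sided argument about such families serves for both sides. *)
Record leavitt_family (G : ultragraph) (A : nuRingType) (s s' : edge G -> A)
    (p : gvset G -> A) : Prop := LeavittFamily {
  lf_p0 : p (gv0 G) = 0;
  lf_pI : forall B C, p B ** p C = p (gvI B C);
  lf_ps : forall e, p (gv1 (esource e)) ** s e = s e;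
  lf_sp : forall e, s e ** p (gvrange e) = s e;
  lf_ps' : forall e, p (gvrange e) ** s' e = s' e;
  lf_s'p : forall e, s' e ** p (gv1 (esource e)) = s' e;
  lf_s's : forall e, s' e ** s e = p (gvrange e);
  lf_s's0 : forall e f, e <> f -> s' e ** s f = 0
}.

Lemma leavitt_family_comm (G : ultragraph) (A : nuRingType) (s s' : edge G -> A)
    (p : gvset G -> A) B C : leavitt_family s s' p -> p B ** p C = p C ** p B.
Proof. by move=> h; rewrite !(lf_pI h); congr p; apply: gvset_eq; exact: setIC. Qed.

Lemma leavitt_family_op (G : ultragraph) (A : nuRingType) (s s' : edge G -> A)
    (p : gvset G -> A) :
  leavitt_family s s' p -> leavitt_family (A := nuop A) s' s p.
Proof.
move=> h; split; rewrite ?nuopE; try by case: h.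
- by move=> B C; rewrite -(lf_pI h) -(leavitt_family_comm _ _ h).
- by move=> e f ef; rewrite nuopE; apply: (lf_s's0 h) => fe; exact: ef.
Qed.

(** * The filtration by path lengths *)

Section FamilySpan.
Variables (K : fieldType) (G : ultragraph) (A : nuAlgType K).
Variables (s s' : edge G -> A) (p : gvset G -> A).

(* The span of the [s_a p_B s_b^*] with [|a| <= m], [|b| <= k] and
   [|a| - |b| = m - k]. *)
Inductive fspan : nat -> nat -> A -> Prop :=
| fspan0 m k : fspan m k 0
| fspanD m k x y : fspan m k x -> fspan m k y -> fspan m k (x + y)
| fspanZ m k c x : fspan m k x -> fspan m k (c *: x)
| fspan_p n B : fspan n n (p B)
| fspan_s m k e x : fspan m k x -> fspan m.+1 k (s e ** x)
| fspan_s' m k e x : fspan m k x -> fspan m k.+1 (x ** s' e).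

Lemma fspan_subgroup m k : is_subgroup (fspan m k).
Proof.
split=> [|x y hx hy]; first exact: fspan0.
by apply: fspanD => //; rewrite -scaleN1r; apply: fspanZ.
Qed.

(** Immediate because [fspan_p] places p_B at every (n,n). This is what brings two elements of the
    same degree into a common V(m,k). *)
Lemma fspan_widen m k x : fspan m k x -> fspan m.+1 k.+1 x.
Proof.
by elim=> {m k x} *; constructor.
Qed.

Lemma fspan_widenD j m k x : fspan m k x -> fspan (j + m) (j + k) x.
Proof. by move=> hx; elim: j => // j IH; apply: fspan_widen. Qed.

End FamilySpan.

Lemma fspan_op (K : fieldType) (G : ultragraph) (A : nuAlgType K)
    (s s' : edge G -> A) (p : gvset G -> A) m k (x : A) :
  fspan s s' p m k x -> fspan (A := nuop A) s' s p k m x.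
Proof.
elim=> {m k x} *.
- exact: fspan0.
- exact: fspanD.
- exact: fspanZ.
- exact: fspan_p.
- exact: (@fspan_s' K G (nuop A)).
- exact: (@fspan_s K G (nuop A)).
Qed.

Lemma fspan_op' (K : fieldType) (G : ultragraph) (A : nuAlgType K)
    (s s' : edge G -> A) (p : gvset G -> A) m k (x : A) :
  fspan (A := nuop A) s' s p k m x -> fspan s s' p m k x.
Proof.
elim=> {m k x} *.
- exact: fspan0.
- exact: fspanD.
- exact: fspanZ.
- exact: fspan_p.
- exact: (@fspan_s' K G A).
- exact: (@fspan_s K G A).
Qed.

Section Family.
Variables (K : fieldType) (G : ultragraph) (A : nuAlgType K).
Variables (s s' : edge G -> A) (p : gvset G -> A).
Hypothesis lf : leavitt_family s s' p.
Local Notation V := (fspan s s' p).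

(** The intersection of B with the singleton of the source of e is that singleton or empty. *)
Lemma family_p_vertex B e :
  p B ** s e = s e /\ s' e ** p B = s' e \/ p B ** s e = 0 /\ s' e ** p B = 0.
Proof.
rewrite -(lf_ps lf) -(lf_s'p lf) -[s' e ** _ ** _]numulA.
rewrite -(leavitt_family_comm B (gv1 (esource e)) lf) numulA (lf_pI lf).
have [Be|Be] := pselect (gvset_car B (esource e)); [left|right].
  rewrite (_ : gvI _ _ = gv1 (esource e)) //.
  by apply: gvset_eq; apply/seteqP; split=> v /= => [[]//|->].
rewrite (_ : gvI _ _ = gv0 G) ?(lf_p0 lf) ?nu0r ?nur0 //.
by apply: gvset_eq; apply/seteqP; split=> v //= [Bv ve]; apply: Be; rewrite -ve.
Qed.

Lemma fspan_pl m k B x : V m k x -> V m k (p B ** x).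
Proof.
elim=> {m k x}.
- by move=> m k; rewrite nur0; exact: fspan0.
- by move=> m k x y _ hx _ hy; rewrite numulDr; exact: fspanD.
- by move=> m k c x _ hx; rewrite -nuscalerAr; exact: fspanZ.
- by move=> n C; rewrite (lf_pI lf); exact: fspan_p.
- move=> m k e x hx _; rewrite numulA; case: (family_p_vertex B e) => -[-> _].
    exact: fspan_s.
  by rewrite nu0r; exact: fspan0.
- by move=> m k e x _ hx; rewrite numulA; exact: fspan_s'.
Qed.

Lemma fspan_s'l m k e x : V m.+1 k x -> V m k (s' e ** x).
Proof.
move mE: m.+1 => m' hx; elim: hx m mE => {m' k x}.
- by move=> _ k m _; rewrite nur0; exact: fspan0.
- by move=> m' k x y _ hx _ hy m mE; rewrite numulDr; apply: fspanD; auto.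
- by move=> m' k c x _ hx m mE; rewrite -nuscalerAr; apply: fspanZ; auto.
- move=> n B m <-; case: (family_p_vertex B e) => -[_ ->]; last exact: fspan0.
  by rewrite -(lf_ps' lf); apply: fspan_s'; exact: fspan_p.
- move=> m' k f x hx _ m [->]; rewrite numulA.
  have [<-|ef] := pselect (e = f); first by rewrite (lf_s's lf); exact: fspan_pl.
  by rewrite (lf_s's0 lf) // nu0r; exact: fspan0.
- by move=> m' k f x _ hx m mE; rewrite numulA; apply: fspan_s'; exact: hx.
Qed.

Lemma fspan_mul m k l x y : V m k x -> V k l y -> V m l (x ** y).
Proof.
move=> hx; elim: hx l y => {m k x}.
- by move=> m k l y _; rewrite nu0r; exact: fspan0.
- by move=> m k x x' _ hx _ hx' l y hy; rewrite numulDl; apply: fspanD; auto.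
- by move=> m k c x _ hx l y hy; rewrite -nuscalerAl; apply: fspanZ; auto.
- by move=> n B l y hy; exact: fspan_pl.
- by move=> m k e x _ hx l y hy; rewrite -numulA; apply: fspan_s; exact: hx.
- move=> m k e x _ hx l y hy; rewrite -numulA; apply: hx; exact: fspan_s'l.
Qed.

(** For duplicate-free [F] an idempotent: the finite substitute for the sum of all range
    projections, which may be infinite. *)
Definition range_sum (F : seq (edge G)) : A := \sum_(e <- F) s e ** s' e.

Lemma range_idem e : (s e ** s' e) ** (s e ** s' e) = s e ** s' e.
Proof. by rewrite numulA -[_ ** s e]numulA (lf_s's lf) (lf_sp lf). Qed.

Lemma range_sum_s F e : uniq F -> e \in F -> range_sum F ** s e = s e.
Proof.
move=> uF eF; rewrite /range_sum nu_suml (bigD1_seq e) //= -numulA (lf_s's lf) (lf_sp lf).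
rewrite big1 ?addr0 // => f fe; rewrite -numulA (lf_s's0 lf) ?nur0 //.
by move=> fE; rewrite fE eqxx in fe.
Qed.

Lemma s'_range_sum F e : uniq F -> e \in F -> s' e ** range_sum F = s' e.
Proof.
move=> uF eF; rewrite /range_sum nu_sumr (bigD1_seq e) //= numulA (lf_s's lf) (lf_ps' lf).
rewrite big1 ?addr0 // => f fe; rewrite numulA (lf_s's0 lf) ?nu0r //.
by move=> fE; rewrite fE eqxx in fe.
Qed.

Lemma range_sum_idem F : uniq F -> range_sum F ** range_sum F = range_sum F.
Proof.
move=> uF; rewrite {2 3}/range_sum nu_sumr; apply: eq_big_seq => e eF.
by rewrite numulA range_sum_s.
Qed.

Lemma p_range_sum B F : p B ** range_sum F = range_sum F ** p B.
Proof.
rewrite /range_sum nu_sumr nu_suml; apply: eq_bigr => e _.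
rewrite numulA -[RHS]numulA; case: (family_p_vertex B e) => -[-> ->] //.
by rewrite nu0r nur0.
Qed.

Lemma fspan_range_sum F : V 1 1 (range_sum F).
Proof.
apply: (subgroup_sum (fspan_subgroup s s' p 1 1)) => e _.
by rewrite -(lf_sp lf); apply: fspan_s'; apply: fspan_s; exact: fspan_p.
Qed.

(* [t] collects the terms [s_a p_B] of [x], those not ending with some [s_e^*]. *)
Lemma fspan_tail m k x : V m k x -> exists (F : seq (edge G)) t,
  [/\ (k <= m)%N -> V (m - k) 0 t, (m < k)%N -> t = 0
    & forall F', uniq F' -> {subset F <= F'} -> x - t = (x - t) ** range_sum F'].
Proof.
elim=> {m k x}.
- move=> m k; exists [::], 0; split=> // [_|F' _ _]; first exact: fspan0.
  by rewrite subrr nu0r.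
- move=> m k x y _ [F [t [h1 h2 h3]]] _ [F' [t' [h1' h2' h3']]].
  (* The two lists can be joined because the induction hypotheses hold for every larger
     duplicate-free list. *)
  exists (F ++ F'), (t + t'); split.
  + by move=> km; apply: fspanD; [exact: h1|exact: h1'].
  + by move=> mk; rewrite h2 // h2' // addr0.
  + move=> E uE sE; have -> : x + y - (t + t') = (x - t) + (y - t') by rewrite opprD addrACA.
    rewrite numulDl -h3 -?h3' // => e eF; apply: sE; rewrite mem_cat eF ?orbT //.
- move=> m k c x _ [F [t [h1 h2 h3]]]; exists F, (c *: t); split.
  + by move=> km; apply: fspanZ; exact: h1.
  + by move=> mk; rewrite h2 // scaler0.
  + by move=> E uE sE; rewrite -scalerBr -nuscalerAl -h3.
- move=> n B; exists [::], (p B); split.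
  + by rewrite subnn => _; exact: fspan_p.
  + by rewrite ltnn.
  + by move=> E _ _; rewrite subrr nu0r.
- move=> m k e x _ [F [t [h1 h2 h3]]]; exists F, (s e ** t); split.
  + move=> km; case: (leqP k m) => [km'|mk]; first by rewrite subSn //; apply: fspan_s; exact: h1.
    by rewrite h2 // nur0; exact: fspan0.
  + by move=> mk; rewrite h2 ?nur0 // (ltn_trans _ mk).
  + by move=> E uE sE; rewrite -nuBr -numulA -h3.
- move=> m k e x _ _; exists [:: e], 0; split=> //.
  + by move=> _; exact: fspan0.
  + by move=> E uE sE; rewrite subr0 -numulA s'_range_sum // sE // inE.
Qed.
End Family.

Section FamilyHead.
Variables (K : fieldType) (G : ultragraph) (A : nuAlgType K).
Variables (s s' : edge G -> A) (p : gvset G -> A).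
Hypothesis lf : leavitt_family s s' p.
Local Notation V := (fspan s s' p).

(** When k < m every word s_a p_B s_b^* in x begins with an edge; this is the vanishing tail of
    [fspan_tail], read in the opposite algebra. *)
Lemma fspan_head m k x : (k < m)%N -> V m k x -> exists2 F, uniq F & x = range_sum s s' F ** x.
Proof.
move=> km /fspan_op hx; have [F [t [_ t0 h]]] := fspan_tail (leavitt_family_op lf) hx.
exists (undup F); first exact: undup_uniq.
have := h (undup F) (undup_uniq F); rewrite t0 // subr0; apply.
by move=> e; rewrite mem_undup.
Qed.

Lemma fspan_sr m k e x : V m k.+1 x -> V m k (x ** s e).
Proof. by move=> hx; apply/fspan_op'/(fspan_s'l (leavitt_family_op lf))/fspan_op. Qed.
End FamilyHead.

(** * Local units and regularity of the elements of V(m,k) *)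

Section FamilyUnit.
Variables (K : fieldType) (G : ultragraph) (A : nuAlgType K).
Variables (s s' : edge G -> A) (p : gvset G -> A).
Hypothesis lf : leavitt_family s s' p.
Local Notation V := (fspan s s' p).

Lemma family_p_sub (B C : gvset G) : gvset_car B `<=` gvset_car C -> p C ** p B = p B.
Proof.
by move=> BC; rewrite (lf_pI lf); congr p; apply: gvset_eq; rewrite /= setIidr.
Qed.

(** Asking that every larger C work lets the induction pass through sums, where the two sets are
    joined. *)
Lemma fspan_lunit m k x : V m k x ->
  exists B : gvset G, forall C : gvset G, gvset_car B `<=` gvset_car C -> p C ** x = x.
Proof.
elim=> {m k x}.
- by move=> _ _; exists (gv0 G) => C _; rewrite nur0.
- move=> m k x y _ [B hB] _ [B' hB']; exists (gvU B B') => C /= BC.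
  rewrite numulDr hB ?hB' // => v Bv; apply: BC; [by right|by left].
- by move=> m k c x _ [B hB]; exists B => C BC; rewrite -nuscalerAr hB.
- by move=> n B; exists B => C BC; exact: family_p_sub.
- move=> m k e x _ _; exists (gv1 (esource e)) => C BC.
  by rewrite -(lf_ps lf) !numulA family_p_sub.
- by move=> m k e x _ [B hB]; exists B => C BC; rewrite numulA hB.
Qed.

Lemma fspan00_comb x : V 0 0 x ->
  exists l : seq (K * gvset G), x = \sum_(c <- l) c.1 *: p c.2.
Proof.
move mE: 0%N => m; move kE: {2}m => k hx; move: mE kE; elim: hx => {m k x}.
- by exists [::]; rewrite big_nil.
- move=> m k x y _ hx _ hy m0 k0; have [l ->] := hx m0 k0; have [l' ->] := hy m0 k0.
  by exists (l ++ l'); rewrite big_cat.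
- move=> m k c x _ hx m0 k0; have [l ->] := hx m0 k0.
  exists [seq (c * d.1, d.2) | d <- l]; rewrite big_map scaler_sumr.
  by apply: eq_bigr => d _; rewrite scalerA.
- by move=> n B _ _; exists [:: (1, B)]; rewrite big_seq1 scale1r.
- by [].
- by move=> m k e x _ _ <-.
Qed.

Lemma fspan00_p_comm x B : V 0 0 x -> x ** p B = p B ** x.
Proof.
move=> /fspan00_comb[l ->]; rewrite nu_suml nu_sumr; apply: eq_bigr => c _.
by rewrite -nuscalerAr -nuscalerAl (leavitt_family_comm _ _ lf).
Qed.

Lemma fspan00_comm x y : V 0 0 x -> V 0 0 y -> x ** y = y ** x.
Proof.
move=> hx /fspan00_comb[l ->]; rewrite nu_suml nu_sumr; apply: eq_bigr => c _.
by rewrite -nuscalerAr -nuscalerAl fspan00_p_comm.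
Qed.

Lemma fspan00_range_sum x F : V 0 0 x -> x ** range_sum s s' F = range_sum s s' F ** x.
Proof.
move=> /fspan00_comb[l ->]; rewrite nu_suml nu_sumr; apply: eq_bigr => c _.
by rewrite -nuscalerAr -nuscalerAl p_range_sum.
Qed.

(** The idempotent g is split along p_B into g1 = p_B g and g2 = g - g1. On g1 the term c1 p_B acts
    as the scalar c1 and is absorbed into c, on g2 it vanishes; both halves involve one projection
    fewer. *)
Lemma fspan00_regular_under (l : seq (K * gvset G)) g c : V 0 0 g -> g ** g = g ->
  regular_in (V 0 0) (c *: g + (\sum_(d <- l) d.1 *: p d.2) ** g).
Proof.
elim: l g c => [|[c1 B] l IH] g c hg gg.
  (* For c = 0 the convention 0^-1 = 0 supplies the witness 0. *)
  rewrite big_nil nu0r addr0; exists (c^-1 *: g); first exact: fspanZ.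
  rewrite -!(nuscalerAl, nuscalerAr) !gg !scalerA.
  by have [->|c0] := eqVneq c 0; [rewrite !mul0r | rewrite mulfK].
rewrite big_cons /=; set S := \sum_(d <- l) _.
pose g1 := p B ** g; pose g2 := g - g1.
have hg1 : V 0 0 g1 by exact: fspan_pl.
have hg2 : V 0 0 g2 by apply: (subgroupB (fspan_subgroup _ _ _ _ _)).
have gg1 : g ** g1 = g1 by rewrite /g1 numulA fspan00_p_comm // -numulA gg.
have g1g1 : g1 ** g1 = g1.
  by rewrite {1}/g1 -numulA gg1 /g1 numulA (family_p_sub (@subset_refl _ _)).
have g1g : g1 ** g = g1 by rewrite /g1 -numulA gg.
have g2g2 : g2 ** g2 = g2 by rewrite /g2 nuBl !nuBr gg g1g1 gg1 g1g subrr subr0.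
have g12 : g1 ** g2 = 0 by rewrite /g2 nuBr g1g1 g1g subrr.
have g21 : g2 ** g1 = 0 by rewrite /g2 nuBl g1g1 gg1 subrr.
have [y1 hy1 e1] := IH g1 (c + c1) hg1 g1g1.
have [y2 hy2 e2] := IH g2 c hg2 g2g2.
set x1 := (c + c1) *: _ + _ in e1; set x2 := c *: _ + _ in e2.
have hS : V 0 0 S.
  apply: (big_ind (V 0 0)); [exact: fspan0 | exact: fspanD |].
  by move=> d _; apply: fspanZ; exact: fspan_p.
have hx1 : V 0 0 x1.
  by apply: fspanD; [exact: fspanZ | exact: (fspan_mul lf hS hg1)].
have hx2 : V 0 0 x2.
  by apply: fspanD; [exact: fspanZ | exact: (fspan_mul lf hS hg2)].
have -> : c *: g + (c1 *: p B + S) ** g = x1 + x2.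
  rewrite /x1 /x2 /g2 numulDl nuBr scalerBr scalerDl -nuscalerAl -/g1.
  rewrite [RHS]addrACA [S ** g1 + _]addrC subrK [c *: g1 + _ + _]addrC addrA.
  by congr (_ + _); rewrite addrA subrK.
have x1g1 : x1 ** g1 = x1 by rewrite /x1 numulDl -nuscalerAl -numulA g1g1.
have x2g2 : x2 ** g2 = x2 by rewrite /x2 numulDl -nuscalerAl -numulA g2g2.
have x1g2 : x1 ** g2 = 0 by rewrite -x1g1 -numulA g12 nur0.
have x2g1 : x2 ** g1 = 0 by rewrite -x2g2 -numulA g21 nur0.
(* Since x1 and x2 live on the orthogonal idempotents g1 and g2 and V(0,0) is commutative, all mixed
   products vanish. *)
clearbody x1 x2 g2 g1; exists (g1 ** y1 + g2 ** y2).
   exact: fspanD (fspan_mul lf hg1 hy1) (fspan_mul lf hg2 hy2).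
have -> : (x1 + x2) ** (g1 ** y1 + g2 ** y2) = x1 ** y1 + x2 ** y2.
  by rewrite numulDr !numulDl !numulA x1g1 x1g2 x2g1 x2g2 ?nu0r addr0 add0r.
have x12 : x1 ** x2 = 0 by rewrite -x1g1 -numulA (fspan00_comm hg1 hx2) x2g1 nur0.
have x21 : x2 ** x1 = 0 by rewrite -x2g2 -numulA (fspan00_comm hg2 hx1) x1g2 nur0.
have y12 : x1 ** y1 ** x2 = 0 by rewrite -numulA (fspan00_comm hy1 hx2) numulA x12 nu0r.
have y21 : x2 ** y2 ** x1 = 0 by rewrite -numulA (fspan00_comm hy2 hx1) numulA x21 nu0r.
by rewrite numulDr !numulDl -e1 -e2 y12 y21 addr0 add0r.
Qed.

Lemma fspan00_regular x : V 0 0 x -> regular_in (V 0 0) x.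
Proof.
move=> hx; have [B hB] := fspan_lunit hx.
have := fspan00_comb hx => -[l xE].
(* Here g is a local unit p_B of x, and no scalar has been absorbed yet. *)
have := @fspan00_regular_under l (p B) 0 (fspan_p _ _ _ 0 B) (family_p_sub (@subset_refl _ _)).
by rewrite scale0r add0r -xE fspan00_p_comm // hB.
Qed.

Section Cut.
Variable q : A.
Hypothesis qq : q ** q = q.

Lemma cut_mul x y : (x - x ** q) ** (y - q ** y) = x ** (y - q ** y).
Proof.
rewrite nuBl -[x ** q ** _]numulA (_ : q ** (y - q ** y) = 0) ?nur0 ?subr0 //.
by rewrite nuBr numulA qq subrr.
Qed.

(** Formally x(1-q) (1-q)y z(1-q) = xyz(1-q), as 1-q commutes with yz. In the applications yz lies
    in V(0,0). *)
Lemma cut_mul3 x y z : q ** (y ** z) = y ** z ** q ->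
  (x - x ** q) ** (y - q ** y) ** (z - z ** q) = x ** y ** z - x ** y ** z ** q.
Proof.
move=> qyz; rewrite cut_mul -numulA.
have -> : (y - q ** y) ** (z - z ** q) = y ** z - y ** z ** q.
  rewrite nuBl !nuBr !numulA -(numulA q) qyz -[y ** z ** q ** q]numulA qq.
  by rewrite subrr subr0.
by rewrite nuBr !numulA.
Qed.
End Cut.

(** This treats the tails of [fspan_tail]. For n = 0 a quasi-inverse in V(0,0) can be cut by q,
    which commutes with V(0,0); for larger n every word begins with an edge e, and s_e^* x falls
    under the case n-1. *)
Lemma fspan_cut_regular n F x : uniq F -> V n 0 x ->
  let q := range_sum s s' F in
  exists2 y, V 0 n y &
    x - x ** q = (x - x ** q) ** (y - q ** y) ** (x - x ** q).
Proof.
move=> uF hx q; have qq : q ** q = q by exact: (range_sum_idem lf).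
elim: n x hx => [|n IH] x hx.
  have [y hy xE] := fspan00_regular hx; exists y => //.
  rewrite cut_mul3 -?xE // fspan00_range_sum //; exact: (fspan_mul lf hy hx).
(* X = V(n+1,0)(1-q) and Y = (1-q)V(0,n+1). Products of a Y-side and an X-side factor before cutting
   lie in V(0,0), those in the other order do not; the cuts make both triple products close up. *)
pose X z := exists2 t, V n.+1 0 t & z = t - t ** q.
pose Y z := exists2 t, V 0 n.+1 t & z = t - q ** t.
have hX : is_subgroup X.
  split=> [|_ _ [t ht ->] [u hu ->]]; first by exists 0; [exact: fspan0|rewrite nu0r subr0].
  exists (t - u); first exact: (subgroupB (fspan_subgroup _ _ _ _ _)).
  by rewrite nuBl !opprB addrACA [RHS]addrACA [- u - _]addrC.
have hY : is_subgroup Y.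
  split=> [|_ _ [t ht ->] [u hu ->]]; first by exists 0; [exact: fspan0|rewrite nur0 subr0].
  exists (t - u); first exact: (subgroupB (fspan_subgroup _ _ _ _ _)).
  by rewrite nuBr !opprB addrACA [RHS]addrACA [- u - _]addrC.
have XYX a b c : X a -> Y b -> X c -> X (a ** b ** c).
  move=> [t ht ->] [u hu ->] [v hv ->]; exists (t ** u ** v).
    exact: (fspan_mul lf (fspan_mul lf ht hu) hv).
  by rewrite cut_mul3 // fspan00_range_sum //; exact: (fspan_mul lf hu hv).
have YXY a b c : Y a -> X b -> Y c -> Y (a ** b ** c).
  move=> [t ht ->] [u hu ->] [v hv ->]; exists (t ** u ** v).
    exact: (fspan_mul lf (fspan_mul lf ht hu) hv).
  have tuq : t ** u ** q = q ** (t ** u).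
    by apply: fspan00_range_sum; exact: (fspan_mul lf ht hu).
  rewrite -numulA cut_mul // numulA nuBl -(numulA q).
  move: (t ** u) tuq => z zq; rewrite nuBl !nuBr !numulA -(numulA q z q) zq !numulA qq.
  by rewrite subrr subr0.
have Vs m k e z : V m k z -> V m.+1 k (s e ** z) by exact: fspan_s.
have Vs' m k e z : V m k z -> V m k.+1 (z ** s' e) by exact: fspan_s'.
have [E _ xE] := fspan_head lf (ltn0Sn n) hx.
suff [_ [y hy ->] yE] : regular_in Y (x - x ** q) by exists y.
apply: (@regular_column A X Y hX hY XYX YXY _ (fun e => s e ** s' e) E).
- exact: (range_idem lf).
- move=> e _ [t ht ->]; exists (s e ** (s' e ** t)); first by apply: Vs; exact: (fspan_s'l lf).
  by rewrite nuBr !numulA.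
- move=> e _ [t ht ->]; exists (t ** s e ** s' e); first by apply: Vs'; exact: (fspan_sr lf).
  by rewrite nuBl !numulA.
- move=> e _ _ [t ht ->]; set z := t - t ** q => tE.
  have [y hy] := IH (s' e ** t) (fspan_s'l lf _ ht).
  have -> : s' e ** t - s' e ** t ** q = s' e ** z by rewrite nuBr numulA.
  (* Since z = s_e (s_e^* z), a quasi-inverse of s_e^* z followed by s_e^* is one of z. *)
  move=> zE; exists ((y - q ** y) ** s' e).
    by exists (y ** s' e); [exact: Vs' | rewrite nuBl numulA].
  by rewrite {1}tE -numulA zE !numulA -tE.
- by exists x.
- by rewrite nuBr numulA -xE.
Qed.

Lemma fspan_regular_le m k x : (k <= m)%N -> V m k x -> regular_in (V k m) x.
Proof.
elim: k m x => [|k IH] m x km hx.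
  (* The empty list gives q = 0, so nothing is cut. *)
  have [y hy] := @fspan_cut_regular m [::] x isT hx.
  by rewrite /range_sum big_nil nur0 nu0r !subr0; exists y.
have hX := fspan_subgroup s s' p m k.+1; have hY := fspan_subgroup s s' p k.+1 m.
have XYX a b c : V m k.+1 a -> V k.+1 m b -> V m k.+1 c -> V m k.+1 (a ** b ** c).
  by move=> ha hb hc; exact: (fspan_mul lf (fspan_mul lf ha hb) hc).
have YXY a b c : V k.+1 m a -> V m k.+1 b -> V k.+1 m c -> V k.+1 m (a ** b ** c).
  by move=> ha hb hc; exact: (fspan_mul lf (fspan_mul lf ha hb) hc).
have Vs i j e z : V i j z -> V i.+1 j (s e ** z) by exact: fspan_s.
have Vs' i j e z : V i j z -> V i j.+1 (z ** s' e) by exact: fspan_s'.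
have row z F : V m k.+1 z -> z = z ** range_sum s s' F -> regular_in (V k.+1 m) z.
  move: z; apply: (@regular_row A _ _ hX hY XYX YXY _ (fun e => s e ** s' e)).
  - exact: (range_idem lf).
  - by move=> e z hz; rewrite numulA; apply: Vs'; exact: (fspan_sr lf).
  - by move=> e z hz; rewrite -numulA; apply: Vs; exact: (fspan_s'l lf).
  move=> f z _ hz zE.
  (* Stripping s_f^* puts z s_f in V(m,k) with k < m, so finitely many first edges fix it from the
     left. *)
  have [E _ zsE] := fspan_head lf km (fspan_sr lf f hz).
  (* The column reduction is confined to elements supported on the single column f. *)
  pose X z := V m k.+1 z /\ z = z ** (s f ** s' f).
  have hX' : is_subgroup X.
    split=> [|a b [ha aE] [hb bE]]; first by split; [exact: fspan0 | rewrite nu0r].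
    by split; [exact: (subgroupB hX) | rewrite nuBl -aE -bE].
  apply: (@regular_column A X _ hX' hY _ _ _ (fun e => s e ** s' e) E).
  - by move=> a b c [ha aE] hb [hc cE]; split; [exact: XYX | rewrite -[RHS]numulA -cE].
  - by move=> a b c ha [hb _] hc; exact: YXY.
  - exact: (range_idem lf).
  - move=> e a [ha aE]; split; last by rewrite -[RHS]numulA -aE.
    by case: (m) km ha => // m' _ ha; rewrite -numulA; apply: Vs; exact: (fspan_s'l lf).
  - move=> e a ha; case: (m) km ha => // m' _ ha.
    by rewrite numulA; apply: Vs'; exact: (fspan_sr lf).
  - move=> e a _ [ha aE] aE'.
    case: (m) km ha => // m' km' ha.
    (* The entry c = s_e^* a s_f recovers a = s_e c s_f^*, so its quasi-inverse b gives s_f b s_e^*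
       for a. *)
    have [b hb bE] := IH m' (s' e ** a ** s f) km' (fspan_sr lf _ (fspan_s'l lf _ ha)).
    exists (s f ** b ** s' e); first by apply: Vs'; exact: Vs.
    rewrite {1}aE' {1}aE; move: bE; set c := s' e ** a ** s f => bE.
    transitivity (s e ** c ** s' f); first by rewrite /c !numulA.
    rewrite bE /c.
    transitivity (s e ** s' e ** a ** s f ** b ** (s' e ** (a ** (s f ** s' f)))).
      by rewrite !numulA.
    by rewrite -aE !numulA -aE'.
  - by [].
  - by rewrite {1}zE numulA {1}zsE -!numulA -zE.
have [F [t [ht _ tE]]] := fspan_tail lf hx.
have uF := undup_uniq F.
have sF : {subset F <= undup F} by move=> e; rewrite mem_undup.
have {}tE := tE (undup F) uF sF.
have [y hy] := fspan_cut_regular uF (ht km).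
move: tE; set q := range_sum s s' _ => tE yE.
have qq : q ** q = q by exact: (range_sum_idem lf).
have x1E : x - x ** q = t - t ** q.
  move/eqP: tE; rewrite nuBl subr_eq => /eqP {1}->.
  by rewrite addrAC [x ** q - _]addrC addrK addrC.
rewrite -x1E in yE.
(* y lies in V(0,m-k-1); widening by k+1 and multiplying by q in V(1,1) stay inside V(k+1,m). *)
have Yy : V k.+1 m (y - q ** y).
  have := fspan_widenD k.+1 hy; rewrite addn0 (_ : (k.+1 + (m - k.+1) = m)%N) ?subnKC // => Vy.
  apply: (subgroupB hY) => //; apply: (fspan_mul lf _ Vy).
  by have := fspan_widenD k (fspan_range_sum lf (undup F)); rewrite addn1.
apply: (regular_reduce hY YXY hx Yy).
set x' := x - _; have hx' : V m k.+1 x' by apply: (subgroupB hX) => //; exact: XYX.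
(* The choice of y means x(1-q) = x(1-q)y x(1-q), that is x'(1-q) = 0: what remains is the matrix
   part, fixed by q. *)
apply: (row x' (undup F)) => //; rewrite -/q.
apply/eqP; rewrite -subr_eq0; apply/eqP.
move: yE; rewrite cut_mul // [_ ** (x - _)]nuBr [_ ** (x ** q)]numulA => yE.
rewrite /x' nuBl opprB addrACA [- _ - _]addrC addrACA yE.
by rewrite addrA subrK subrr.
Qed.

End FamilyUnit.

Lemma fspan_regular (K : fieldType) (G : ultragraph) (A : nuAlgType K)
    (s s' : edge G -> A) (p : gvset G -> A) m k x :
  leavitt_family s s' p -> fspan s s' p m k x -> regular_in (fspan s s' p k m) x.
Proof.
move=> lf; case: (leqP k m) => [km|/ltnW mk] hx; first exact: fspan_regular_le.
have [y hy xE] := fspan_regular_le (leavitt_family_op lf) mk (fspan_op hx).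
by exists y; [exact: fspan_op' | rewrite {1}xE -numulA].
Qed.

(** * Homogeneous components *)

Lemma big_uniq_supp (V : zmodType) (I : eqType) (s S : seq I) (c : I -> V) :
  uniq s -> uniq S -> {subset s <= S} -> (forall i, i \notin s -> c i = 0) ->
  \sum_(i <- S) c i = \sum_(i <- s) c i.
Proof.
move=> us uS sS c0; rewrite (bigID (mem s)) /= [X in _ + X]big1 // addr0.
rewrite -big_filter; apply: perm_big; apply: uniq_perm => //; first exact: filter_uniq.
by move=> i; rewrite mem_filter; case: (boolP (i \in s)) => //= /sS ->.
Qed.

(** The index lists of a grading may repeat degrees; here they are merged. A general family [P] is
    needed because the lemma serves both for the components [V_ n] and for their intersections with
    a graded subset. *)
Lemma sum_collect (V : zmodType) (P : int -> set V) (s : seq int) (c : int -> V) :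
  (forall n, is_subgroup (P n)) -> (forall n, P n (c n)) ->
  exists (s' : seq int) (c' : int -> V), [/\ uniq s', forall n, P n (c' n),
    forall n, n \notin s' -> c' n = 0 & \sum_(n <- s) c n = \sum_(n <- s') c' n].
Proof.
move=> hP Pc; elim: s => [|m s [s' [c' [us' Pc' c0 sE]]]].
  exists [::], (fun=> 0); split=> //; last by rewrite !big_nil.
  by move=> n; exact: (subgroup0 (hP n)).
have uS := undup_uniq (m :: s').
have ES : undup (m :: s') =i m :: s' by exact: mem_undup.
move: (undup _) uS ES => S uS ES.
exists S, (fun n => (if n == m then c m else 0) + c' n); split=> //.
- move=> n; apply: (subgroupD (hP n)) => //.
  by case: eqP => [->|_] //; exact: (subgroup0 (hP n)).
- by move=> n; rewrite ES inE negb_or => /andP[/negPf -> /c0 ->]; rewrite addr0.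
- rewrite big_cons sE big_split /=; congr (_ + _).
    rewrite (bigD1_seq m) ?ES ?inE ?eqxx //= big1 ?addr0 // => n.
    by move/negPf ->.
  symmetry; apply: big_uniq_supp => //.
  by move=> n ns; rewrite ES inE ns orbT.
Qed.

Section Components.
Variables (V : zmodType) (V_ : int -> set V).
Hypothesis hV : is_direct_sum V_.

Lemma direct_sum_subgroup n : is_subgroup (V_ n). Proof. by case: hV. Qed.

Lemma components_exist x : exists sc : seq int * (int -> V),
  [/\ uniq sc.1, forall n, V_ n (sc.2 n), forall n, n \notin sc.1 -> sc.2 n = 0
    & x = \sum_(n <- sc.1) sc.2 n].
Proof.
have [_ /(_ x)[s [c [Vc ->]]] _] := hV.
have [s' [c' [? ? ? ->]]] := sum_collect s direct_sum_subgroup Vc.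
by exists (s', c').
Qed.

(** A chosen list that contains the support; it may also contain degrees whose component is zero. *)
Definition hsupp (x : V) : seq int := (projT1 (cid (components_exist x))).1.
Definition hcomp (x : V) : int -> V := (projT1 (cid (components_exist x))).2.

Lemma hcompP x : [/\ uniq (hsupp x), forall n, V_ n (hcomp x n),
  forall n, n \notin hsupp x -> hcomp x n = 0 & x = \sum_(n <- hsupp x) hcomp x n].
Proof. exact: (projT2 (cid (components_exist x))). Qed.

Lemma hsupp_uniq x : uniq (hsupp x). Proof. by case: (hcompP x). Qed.
Lemma hcomp_in x n : V_ n (hcomp x n). Proof. by case: (hcompP x). Qed.
Lemma hcomp_out x n : n \notin hsupp x -> hcomp x n = 0.
Proof. by case: (hcompP x) => _ _ h _; exact: h. Qed.
Lemma hcomp_sum x : x = \sum_(n <- hsupp x) hcomp x n.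
Proof. by case: (hcompP x). Qed.

Lemma hcomp_sum_sub x S : uniq S -> {subset hsupp x <= S} -> x = \sum_(n <- S) hcomp x n.
Proof.
move=> uS sS; rewrite (big_uniq_supp (hsupp_uniq x)) //; first exact: hcomp_sum.
by move=> n; exact: hcomp_out.
Qed.

Lemma hcomp_unique x s c : uniq s -> (forall n, V_ n (c n)) ->
  (forall n, n \notin s -> c n = 0) -> x = \sum_(n <- s) c n -> hcomp x = c.
Proof.
move=> us Vc c0 xE; apply/funext => n.
pose S := undup (n :: s ++ hsupp x).
have uS : uniq S by exact: undup_uniq.
have [_ _ h] := hV.
apply/eqP; rewrite -subr_eq0; apply/eqP.
apply: (h S (fun m => hcomp x m - c m)) => //.
- by move=> m; apply: (subgroupB (direct_sum_subgroup m)) => //; exact: hcomp_in.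
- rewrite sumrB -hcomp_sum_sub //; last first.
    by move=> m ms; rewrite mem_undup inE mem_cat ms !orbT.
  rewrite (big_uniq_supp us) // -?xE ?subrr // => m ms.
  by rewrite mem_undup inE mem_cat ms !orbT.
- by rewrite mem_undup inE eqxx.
Qed.

Lemma hcompB x y n : hcomp (x - y) n = hcomp x n - hcomp y n.
Proof.
rewrite (@hcomp_unique (x - y) (undup (hsupp x ++ hsupp y))
  (fun n => hcomp x n - hcomp y n)) //.
- exact: undup_uniq.
- by move=> m; apply: (subgroupB (direct_sum_subgroup m)); exact: hcomp_in.
- by move=> m; rewrite mem_undup mem_cat negb_or => /andP[mx my]; rewrite !hcomp_out ?subrr.
- by rewrite sumrB -!hcomp_sum_sub ?undup_uniq // => m ms; rewrite mem_undup mem_cat ms ?orbT.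
Qed.

Lemma hcomp0 n : hcomp 0 n = 0.
Proof. by rewrite -[X in hcomp X](subrr 0) hcompB subrr. Qed.

Lemma hcompN x n : hcomp (- x) n = - hcomp x n.
Proof. by rewrite -sub0r hcompB hcomp0 sub0r. Qed.

Lemma hcompD x y n : hcomp (x + y) n = hcomp x n + hcomp y n.
Proof. by rewrite -{1}[y]opprK hcompB hcompN opprK. Qed.

Lemma hcomp_sumE I (r : seq I) (F : I -> V) n :
  hcomp (\sum_(i <- r) F i) n = \sum_(i <- r) hcomp (F i) n.
Proof. exact: (big_morph (fun x => hcomp x n) (fun x y => hcompD x y n) (hcomp0 n)). Qed.

Lemma hcomp_hom n x m : V_ n x -> hcomp x m = if m == n then x else 0.
Proof.
move=> Vx; rewrite (@hcomp_unique x [:: n] (fun m => if m == n then x else 0)) //.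
- by move=> k; case: eqP => [->|_] //; exact: (subgroup0 (direct_sum_subgroup k)).
- by move=> k; rewrite inE => /negPf ->.
- by rewrite big_seq1 eqxx.
Qed.

Lemma graded_hcomp (U : set V) : is_subgroup U -> is_graded_subset V_ U ->
  forall x n, U x -> U (hcomp x n).
Proof.
move=> hU gU x n Ux; have [s [c [hc xE]]] := gU x Ux.
have hP m : is_subgroup (V_ m `&` U).
  split=> [|y z [Vy Uy] [Vz Uz]].
    by split; [exact: (subgroup0 (direct_sum_subgroup m)) | exact: (subgroup0 hU)].
  by split; [exact: (subgroupB (direct_sum_subgroup m)) | exact: (subgroupB hU)].
have [s' [c' [us' hc' c0]]] := sum_collect s hP hc; rewrite -xE => xE'.
have -> : hcomp x = c' by apply: (hcomp_unique us' _ c0 xE') => m; case: (hc' m).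
by case: (hc' n).
Qed.

Lemma hcomp_graded (U : set V) :
  (forall x n, U x -> U (hcomp x n)) -> is_graded_subset V_ U.
Proof.
move=> h x Ux; exists (hsupp x), (hcomp x); split; last exact: hcomp_sum.
by move=> n; split; [exact: hcomp_in | exact: h].
Qed.
End Components.

(** * Graded regular rings *)

Lemma is_graded_ring_op (A : nuRingType) (A_ : int -> set A) :
  is_graded_ring A_ -> is_graded_ring (A := nuop A) A_.
Proof. by move=> [h hm]; split=> // m n x y hx hy; rewrite addrC; exact: hm. Qed.

Lemma left_ideal_genP (A : nuRingType) (X : set A) : left_ideal (left_ideal_gen X).
Proof.
split; first split.
- by move=> I [[hI _] _]; exact: (subgroup0 hI).
- by move=> x y hx hy I hI; apply: (subgroupB hI.1.1); [exact: hx|exact: hy].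
- by move=> x a hx I hI; apply: hI.1.2; exact: hx.
Qed.

Section GradedRegular.
Variables (A : nuRingType) (A_ : int -> set A).
Hypothesis gA : is_graded_ring A_.
Hypothesis regA : forall n x, A_ n x -> regular_in (A_ (- n)) x.
Let dA : is_direct_sum A_ := gA.1.
Let sA n : is_subgroup (A_ n) := direct_sum_subgroup dA n.

Lemma graded_mul m n k x y : A_ m x -> A_ n y -> k = m + n -> A_ k (x ** y).
Proof. by move=> hx hy ->; exact: gA.2. Qed.

(** If e already fixes the earlier a_i, let c = a_j - a_j e = cyc and z = y - ey. Then a_i z = 0 and
    a_j z c = cyc = c, so e + zc fixes a_j as well; expanding zc in the a_i gives the new b_i. *)
Lemma homogeneous_right_unit (J : eqType) (s : seq J) (d : J -> int) (a : J -> A) :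
  uniq s -> (forall j, j \in s -> A_ (d j) (a j)) ->
  exists b : J -> A, (forall j, j \in s -> A_ (- d j) (b j)) /\
    forall j, j \in s -> a j ** (\sum_(i <- s) b i ** a i) = a j.
Proof.
elim: s => [|j s IH] /=; first by exists (fun=> 0).
case/andP=> js us ha.
have [b [hb]] := IH us (fun i is_ => ha i (mem_behead (s := j :: s) is_)).
set e := \sum_(i <- s) _ => be.
have he : A_ 0 e.
  apply: (subgroup_sum (sA 0)) => i is_.
  by apply: (graded_mul (hb i is_) (ha i _)); rewrite ?addNr // inE is_ orbT.
have haj : A_ (d j) (a j) by apply: ha; rewrite inE eqxx.
have haje : A_ (d j) (a j - a j ** e).
  by apply: (subgroupB (sA _)) => //; apply: (graded_mul haj he); rewrite addr0.
have [y hy yE] := regA haje; set c := a j - _ in haje yE.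
pose z := y - e ** y.
have hz : A_ (- d j) z.
  by apply: (subgroupB (sA _)) => //; apply: (graded_mul he hy); rewrite add0r.
have hza : A_ 0 (z ** a j) by apply: (graded_mul hz haj); rewrite addNr.
exists (fun i => if i == j then z else b i - z ** a j ** b i); split=> [i|].
  rewrite inE; case: eqP => [-> //|_ /= is_].
  apply: (subgroupB (sA _)); first exact: hb.
  by apply: (graded_mul hza (hb i is_)); rewrite add0r.
have -> : \sum_(i <- j :: s) (if i == j then z else b i - z ** a j ** b i) ** a i
    = e + z ** c.
  rewrite big_cons eqxx /c nuBr addrCA; congr (_ + _).
  rewrite numulA {1 2}/e nu_sumr -sumrB; apply: eq_big_seq => i is_.
  by case: eqP => [ij|_]; [rewrite -ij is_ in js | rewrite nuBl !numulA].
move=> i; rewrite inE => /orP[/eqP ->|is_]; last first.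
  by rewrite numulDr be // numulA /z nuBr numulA be // subrr nu0r addr0.
by rewrite numulDr numulA /z nuBr numulA -nuBl -/c -yE /c addrC subrK.
Qed.

(** The generators are replaced by their finitely many homogeneous components a_j. The element e =
    sum of the b_j a_j lies in I, and a_j e = a_j makes it both idempotent and a generator. *)
Lemma graded_left_ideal_principal (I : set A) :
  graded_left_ideal A_ I -> (exists l : seq A, I = left_ideal_gen [set` l]) ->
  exists e, [/\ homogeneous A_ e, idempotent_elt e & I = left_ideal_gen [set e]].
Proof.
move=> [[hI mI] gI] [l IE].
pose s := undup [seq (x, n) | x <- l, n <- hsupp dA x].
pose a (j : A * int) := hcomp dA j.1 j.2.
have ha j : j \in s -> A_ j.2 (a j) by move=> _; exact: hcomp_in.
have Ia j : j \in s -> I (a j).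
  rewrite mem_undup => /allpairsPdep[x [n [xl _ ->]]]; apply: graded_hcomp => //.
  by rewrite IE => J [_]; apply.
have [b [hb bE]] := homogeneous_right_unit (undup_uniq _ : uniq s) ha.
set e := \sum_(i <- s) _ in bE.
exists e; split.
- exists 0; apply: (subgroup_sum (sA 0)) => i is_.
  by apply: (graded_mul (hb i is_) (ha i is_)); rewrite addNr.
- by rewrite /idempotent_elt {1}/e nu_suml; apply: eq_big_seq => i is_; rewrite -numulA bE.
- apply/seteqP; split; last first.
    have Ie : I e by apply: (subgroup_sum hI) => i is_; apply: mI; exact: Ia.
    by move=> x; apply; split=> // _ ->.
  rewrite IE => x; apply; split; first exact: left_ideal_genP.
  move=> y /= yl J [[hJ mJ] eJ]; rewrite (hcomp_sum dA y); apply: (subgroup_sum hJ) => n ny.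
  have js : (y, n) \in s.
    by rewrite mem_undup; apply/allpairsPdep; exists y, n.
  by rewrite -[hcomp _ _ _](bE (y, n)) //; apply: mJ; exact: eJ.
Qed.

Lemma graded_right_ideal_idempotent (I : set A) :
  graded_right_ideal A_ I -> idempotent_ideal I.
Proof.
move=> [[hI mI] gI]; apply/seteqP; split=> [x [l [hl ->]]|x Ix].
  by apply: (subgroup_sum hI) => c cl; apply: mI; exact: (hl c cl).1.
have h n : exists y, hcomp dA x n = hcomp dA x n ** y ** hcomp dA x n.
  by have [y _ yE] := regA (hcomp_in dA x n); exists y.
pose y n := projT1 (cid (h n)).
have Ic n : I (hcomp dA x n) by exact: graded_hcomp.
exists [seq (hcomp dA x n ** y n, hcomp dA x n) | n <- hsupp dA x]; split.
  by move=> _ /mapP[n _ ->] /=; split=> //; exact: mI.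
rewrite big_map {1}(hcomp_sum dA x); apply: eq_bigr => n _ /=.
by rewrite /y; case: cid.
Qed.

Lemma graded_left_ideal_idempotent (I : set A) :
  graded_left_ideal A_ I -> idempotent_ideal I.
Proof.
move=> [[hI mI] gI]; apply/seteqP; split=> [x [l [hl ->]]|x Ix].
  by apply: (subgroup_sum hI) => c cl; apply: mI; exact: (hl c cl).2.
have h n : exists y, hcomp dA x n = hcomp dA x n ** y ** hcomp dA x n.
  by have [y _ yE] := regA (hcomp_in dA x n); exists y.
pose y n := projT1 (cid (h n)).
have Ic n : I (hcomp dA x n) by exact: graded_hcomp.
exists [seq (hcomp dA x n, y n ** hcomp dA x n) | n <- hsupp dA x]; split.
  by move=> _ /mapP[n _ ->] /=; split=> //; exact: mI.
rewrite big_map {1}(hcomp_sum dA x); apply: eq_bigr => n _ /=.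
by rewrite /y; case: cid => z /= zE; rewrite numulA.
Qed.

Lemma graded_ideal_semiprime (P : set A) : graded_ideal A_ P -> graded_semiprime A_ P.
Proof.
move=> hP; split=> // I n [rI lI gI].
have II : ideal_mul I I = I by exact: graded_right_ideal_idempotent.
suff -> : ideal_expS I n = I by [].
by elim: n => //= n ->.
Qed.

End GradedRegular.

Lemma graded_right_ideal_principal (A : nuRingType) (A_ : int -> set A) :
  is_graded_ring A_ -> (forall n x, A_ n x -> regular_in (A_ (- n)) x) ->
  forall I : set A,
  graded_right_ideal A_ I -> (exists l : seq A, I = right_ideal_gen [set` l]) ->
  exists e, [/\ homogeneous A_ e, idempotent_elt e & I = right_ideal_gen [set e]].
Proof.
move=> gA regA; apply: (@graded_left_ideal_principal (nuop A) A_ (is_graded_ring_op gA)).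
by move=> n x /regA; move/regular_op.
Qed.

(** * Tensor products and flatness *)

Section FreegInt.
Variable T : choiceType.
Implicit Types t u : {freeg T / int}.

Lemma freeg_int_ind (P : {freeg T / int} -> Prop) :
  P 0 -> (forall t u, P t -> P u -> P (t - u)) -> (forall p, P << p >>) -> forall t, P t.
Proof.
move=> P0 PB P1 t.
have PN u : P u -> P (- u) by move=> Pu; rewrite -sub0r; exact: PB.
have PD u v : P u -> P v -> P (u + v).
  by move=> Pu Pv; rewrite -[v]opprK; apply: PB => //; exact: PN.
have PM u n : P u -> P (u *+ n).
  by move=> Pu; elim: n => // n IH; rewrite mulrS; exact: PD.
rewrite -(freeg_sumE t); apply: (big_ind P) => // p _.
rewrite -[coeff p t]intz -freegU_mulz.
by case: (coeff p t) => n; [rewrite -pmulrn | rewrite NegzE -nmulrn; apply: PN]; exact: PM.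
Qed.

(** [fglift] expects a module over [int]; [zmodule V] is the additive group V seen as one. *)
Definition flift (V : zmodType) (f : T -> V) (t : {freeg T / int}) : V :=
  fglift (f : T -> zmodule V) t.

Lemma fliftB (V : zmodType) (f : T -> V) t u : flift f (t - u) = flift f t - flift f u.
Proof. exact: (@lift_is_additive _ _ (zmodule V)). Qed.

Lemma flift1 (V : zmodType) (f : T -> V) p : flift f << p >> = f p.
Proof. by rewrite /flift liftU scale1r. Qed.

Lemma flift0 (V : zmodType) (f : T -> V) : flift f 0 = 0.
Proof. by rewrite -[X in flift f X](subrr 0) fliftB subrr. Qed.

Lemma fliftD (V : zmodType) (f : T -> V) t u : flift f (t + u) = flift f t + flift f u.
Proof. by rewrite -{1}[u]opprK fliftB -[- u]sub0r fliftB flift0 sub0r opprK. Qed.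
End FreegInt.

Section ModuleTheory.
Variable A : nuRingType.

Section Right.
Variable M : rmodule A.
Implicit Types (x y : M) (a b : A).
Lemma ract0l a : ract (0 : M) a = 0.
Proof. by apply: (addrI (ract 0 a)); rewrite -ractDl !addr0. Qed.
Lemma ract0r x : ract x 0 = 0.
Proof. by apply: (addrI (ract x 0)); rewrite -ractDr !addr0. Qed.
Lemma ractNl x a : ract (- x) a = - ract x a.
Proof. by apply: (addrI (ract x a)); rewrite -ractDl !subrr ract0l. Qed.
Lemma ractNr x a : ract x (- a) = - ract x a.
Proof. by apply: (addrI (ract x a)); rewrite -ractDr !subrr ract0r. Qed.
Lemma ractBl x y a : ract (x - y) a = ract x a - ract y a.
Proof. by rewrite ractDl ractNl. Qed.
Lemma ractBr x a b : ract x (a - b) = ract x a - ract x b.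
Proof. by rewrite ractDr ractNr. Qed.
Lemma ract_suml I (r : seq I) (F : I -> M) a :
  ract (\sum_(i <- r) F i) a = \sum_(i <- r) ract (F i) a.
Proof. exact: (big_morph (fun x => ract x a) (fun x y => ractDl x y a) (ract0l a)). Qed.
Lemma ract_sumr I (r : seq I) (F : I -> A) x :
  ract x (\sum_(i <- r) F i) = \sum_(i <- r) ract x (F i).
Proof. exact: (big_morph (ract x) (ractDr x) (ract0r x)). Qed.
End Right.

Section Left.
Variable M : lmodule A.
Implicit Types (x y : M) (a b : A).
Lemma lact0l x : lact (0 : A) x = 0.
Proof. by apply: (addrI (lact 0 x)); rewrite -lactDl !addr0. Qed.
Lemma lact0r a : lact a (0 : M) = 0.
Proof. by apply: (addrI (lact a 0)); rewrite -lactDr !addr0. Qed.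
Lemma lactNl a x : lact (- a) x = - lact a x.
Proof. by apply: (addrI (lact a x)); rewrite -lactDl !subrr lact0l. Qed.
Lemma lactNr a x : lact a (- x) = - lact a x.
Proof. by apply: (addrI (lact a x)); rewrite -lactDr !subrr lact0r. Qed.
Lemma lactBl a b x : lact (a - b) x = lact a x - lact b x.
Proof. by rewrite lactDl lactNl. Qed.
Lemma lact_suml I (r : seq I) (F : I -> A) x :
  lact (\sum_(i <- r) F i) x = \sum_(i <- r) lact (F i) x.
Proof. exact: (big_morph (fun a => lact a x) (fun a b => lactDl a b x) (lact0l x)). Qed.
Lemma lact_sumr I (r : seq I) (F : I -> M) a :
  lact a (\sum_(i <- r) F i) = \sum_(i <- r) lact a (F i).
Proof. exact: (big_morph (lact a) (lactDr a) (lact0r a)). Qed.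
End Left.

(** * Equality of tensors and the relations behind a null tensor *)

Section Tensor.
Variables (M : rmodule A) (N : lmodule A).
Local Notation FG := {freeg (M * N)%type / int}.
Implicit Types t u v : FG.

Lemma tensor_null_subgroup : is_subgroup (@tensor_null A M N).
Proof. by split; [exact: tn_zero | exact: tn_sub]. Qed.

(** Equality in the tensor product, without forming the quotient. *)
Definition teq t u := tensor_null (t - u).

Lemma teq_refl t : teq t t. Proof. by rewrite /teq subrr; exact: tn_zero. Qed.
Lemma teq_sym t u : teq t u -> teq u t.
Proof. by rewrite /teq -opprB => /(subgroupN tensor_null_subgroup); rewrite opprK. Qed.
Lemma teq_trans u t v : teq t u -> teq u v -> teq t v.
Proof.
by move=> tu uv; have := subgroupD tensor_null_subgroup tu uv; rewrite addrA subrK.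
Qed.
Lemma teqB t t' u u' : teq t t' -> teq u u' -> teq (t - u) (t' - u').
Proof.
move=> ht hu; rewrite /teq (_ : _ - _ = (t - t') - (u - u')); first exact: tn_sub.
by rewrite !opprB addrACA [RHS]addrACA [- t' - _]addrC.
Qed.
Lemma teqD t t' u u' : teq t t' -> teq u u' -> teq (t + u) (t' + u').
Proof.
move=> ht hu; have := teqB ht (teqB (teq_refl 0) hu).
by rewrite !sub0r !opprK.
Qed.
Lemma teq_sum (I : eqType) (r : seq I) (F F' : I -> FG) :
  (forall i, i \in r -> teq (F i) (F' i)) -> teq (\sum_(i <- r) F i) (\sum_(i <- r) F' i).
Proof.
elim: r => [|i r IH] h; first by rewrite !big_nil; exact: teq_refl.
rewrite !big_cons; apply: teqD; first by apply: h; rewrite inE eqxx.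
by apply: IH => j jr; apply: h; rewrite inE jr orbT.
Qed.

Lemma teq_sum0 I (r : seq I) (P : pred I) (F : I -> FG) : (forall i, P i -> teq 0 (F i)) ->
  teq 0 (\sum_(i <- r | P i) F i).
Proof.
move=> h; apply: (big_ind (teq 0)) => //; first exact: teq_refl.
by move=> t u ht hu; have := teqD ht hu; rewrite addr0.
Qed.

Lemma teq_pure0l (y : N) : teq 0 (pure_tensor (0 : M) y).
Proof. by have := tn_addl (0 : M) 0 y; rewrite addr0 opprD addrA subrr. Qed.

Lemma teq_pure0r (x : M) : teq 0 (pure_tensor x (0 : N)).
Proof. by have := tn_addr x (0 : N) 0; rewrite addr0 opprD addrA subrr. Qed.

Lemma teq_suml I (r : seq I) (F : I -> M) (y : N) :
  teq (pure_tensor (\sum_(i <- r) F i) y) (\sum_(i <- r) pure_tensor (F i) y).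
Proof.
elim: r => [|i r IH]; last first.
  rewrite !big_cons.
  apply: (teq_trans (u := pure_tensor (F i) y + pure_tensor (\sum_(j <- r) F j) y)).
    exact: tn_addl.
  by apply: teqD => //; exact: teq_refl.
rewrite !big_nil; apply: teq_sym; exact: teq_pure0l.
Qed.

Lemma teq_sumr I (r : seq I) (x : M) (F : I -> N) :
  teq (pure_tensor x (\sum_(i <- r) F i)) (\sum_(i <- r) pure_tensor x (F i)).
Proof.
elim: r => [|i r IH]; last first.
  rewrite !big_cons.
  apply: (teq_trans (u := pure_tensor x (F i) + pure_tensor x (\sum_(j <- r) F j))).
    exact: tn_addr.
  by apply: teqD => //; exact: teq_refl.
rewrite !big_nil; apply: teq_sym; exact: teq_pure0r.
Qed.

(** The coordinate at x of the image of t in the direct sum of copies of N indexed by M; only the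
    relations that are additive in N have been divided out. *)
Definition fiber t (x : M) : N := flift (fun p => if p.1 == x then p.2 else 0) t.

Lemma fiberB t u x : fiber (t - u) x = fiber t x - fiber u x.
Proof. exact: fliftB. Qed.
Lemma fiberD t u x : fiber (t + u) x = fiber t x + fiber u x.
Proof. exact: fliftD. Qed.
Lemma fiber0 x : fiber 0 x = 0.
Proof. exact: flift0. Qed.
Lemma fiber_pure (z : M) (y : N) x : fiber (pure_tensor z y) x = if z == x then y else 0.
Proof. exact: flift1. Qed.

Lemma sum_delta (V : zmodType) (I : eqType) (S : seq I) (z : I) (v : I -> V) :
  uniq S -> z \in S -> (forall x, x != z -> v x = 0) -> \sum_(x <- S) v x = v z.
Proof. by move=> uS zS v0; rewrite (bigD1_seq z) //= big1 ?addr0. Qed.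

Lemma teq_fiber t : exists X : seq M, forall S, uniq S -> {subset X <= S} ->
  teq t (\sum_(x <- S) pure_tensor x (fiber t x)).
Proof.
elim/freeg_int_ind: t => [|t u [X hX] [Y hY]|[z y]].
- by exists [::] => S _ _; apply: teq_sum0 => x _; rewrite fiber0; exact: teq_pure0r.
- exists (X ++ Y) => S uS sS.
  apply: (teq_trans (u := \sum_(x <- S) pure_tensor x (fiber t x) -
      \sum_(x <- S) pure_tensor x (fiber u x))).
    by apply: teqB; [apply: hX|apply: hY] => // x xX; apply: sS; rewrite mem_cat xX ?orbT.
  rewrite -sumrB; apply: teq_sum => x _; rewrite fiberB; apply: teq_sym.
  apply: (teq_trans (u := pure_tensor x (fiber t x - fiber u x) + pure_tensor x (fiber u x)
     - pure_tensor x (fiber u x))).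
    by rewrite addrK; exact: teq_refl.
  apply: teqB; last exact: teq_refl; apply: teq_sym.
  by have := tn_addr x (fiber t x - fiber u x) (fiber u x); rewrite subrK.
- exists [:: z] => S uS /(_ z); rewrite inE eqxx => /(_ isT) zS.
  rewrite (bigD1_seq z) //= -[X in teq X]addr0; apply: teqD.
    by rewrite fiber_pure eqxx; exact: teq_refl.
  apply: teq_sum0 => x xz; rewrite fiber_pure eq_sym (negPf xz); exact: teq_pure0r.
Qed.

(* An element of the null subgroup is supported, fibrewise in [N], by finitely
   many A-linear relations [\sum_x x (r.1 x) = 0] between elements of [M]. *)
Lemma tensor_null_relations t : unital_lmodule N -> tensor_null t ->
  exists (l : seq ((M -> A) * N)) (X : seq M),
    (forall S, uniq S -> {subset X <= S} -> forall r, r \in l ->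
       (forall x, x \notin S -> r.1 x = 0) /\ \sum_(x <- S) ract x (r.1 x) = 0) /\
    forall x, fiber t x = \sum_(r <- l) lact (r.1 x) r.2.
Proof.
move=> uN; pose d (z : M) (a : A) := fun x => if z == x then a else 0.
have dE (S : seq M) z a : uniq S -> z \in S -> \sum_(x <- S) ract x (d z a x) = ract z a.
  move=> uS zS; rewrite (sum_delta uS zS) /d ?eqxx // => x xz.
  by rewrite eq_sym (negPf xz) ract0r.
have d0 (S : seq M) z a x : z \in S -> x \notin S -> d z a x = 0.
  by move=> zS xS; rewrite /d; case: eqP => // zx; rewrite -zx zS in xS.
have dl z x (ly : seq (A * N)) : \sum_(c <- ly) lact (d z c.1 x) c.2 =
    if z == x then \sum_(c <- ly) lact c.1 c.2 else 0.
  by rewrite /d; case: eqP => // _; rewrite big1 // => c _; rewrite lact0l.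
elim=> {t} [|t u _ [l [X [hl lE]]] _ [l' [X' [hl' lE']]]|x x' y|x y y'|x a y].
- by exists [::], [::]; split=> // x; rewrite big_nil fiber0.
- exists (l ++ [seq (r.1, - r.2) | r <- l']), (X ++ X'); split.
    move=> S uS sS r; rewrite mem_cat => /orP[rl|/mapP[r' rl' ->]].
      by apply: hl => // x xX; apply: sS; rewrite mem_cat xX.
    by apply: (hl' S uS _ r' rl') => x xX; apply: sS; rewrite mem_cat xX orbT.
  move=> x; rewrite fiberB lE lE' big_cat big_map -sumrN; congr (_ + _).
  by apply: eq_bigr => r _ /=; rewrite lactNr.
(* The relation (x + x') - x - x' = 0 has coefficients 1, absent from A; writing y as a sum of
   products c.1 c.2 turns it into one relation with coefficients c.1 for each term. *)
- have [ly yE] := uN y.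
  exists [seq ((fun z => d (x + x') c.1 z - (d x c.1 z + d x' c.1 z)), c.2) | c <- ly],
    [:: x + x'; x; x']; split.
    move=> S uS sS _ /mapP[c _ ->] /=.
    have [S1 S2 S3] : [/\ x + x' \in S, x \in S & x' \in S].
      by split; apply: sS; rewrite !inE eqxx ?orbT.
    split=> [z zS|]; first by rewrite !(d0 S) // addr0 subr0.
    under eq_bigr do rewrite ractBr ractDr.
    by rewrite sumrB big_split /= !dE // ractDl subrr.
  move=> z; rewrite fiberB fiberD !fiber_pure big_map /=.
  under eq_bigr do rewrite lactBl lactDl.
  by rewrite sumrB big_split /= !dl -yE.
(* Additivity in N is already built into the fibres, so all of them vanish. *)
- exists [::], [::]; split=> // z; rewrite big_nil fiberB.
  rewrite fiberD !fiber_pure; case: eqP => _; last by rewrite addr0 subrr.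
  by rewrite subrr.
(* As above, with the relations (xa) c.1 - x (a c.1) = 0. *)
- have [ly yE] := uN y.
  exists [seq ((fun z => d (ract x a) c.1 z - d x (a ** c.1) z), c.2) | c <- ly],
    [:: ract x a; x]; split.
    move=> S uS sS _ /mapP[c _ ->] /=.
    have [S1 S2] : [/\ ract x a \in S & x \in S].
      by split; apply: sS; rewrite !inE eqxx ?orbT.
    split=> [z zS|]; first by rewrite !(d0 S) // subr0.
    under eq_bigr do rewrite ractBr.
    by rewrite sumrB !dE // ractA subrr.
  move=> z; rewrite fiberB !fiber_pure big_map /=.
  under eq_bigr do rewrite lactBl.
  rewrite sumrB dl -yE; congr (_ - _); rewrite /d; case: eqP => _; last first.
    by rewrite big1 // => c _; rewrite lact0l.
  by rewrite {1}yE lact_sumr; apply: eq_bigr => c _; rewrite lactA.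
Qed.

End Tensor.
End ModuleTheory.

Lemma tensor_map_morph (A : nuRingType) (M M' : rmodule A) (N N' : lmodule A)
    (f : M -> M') (g : N -> N') :
  [/\ tensor_map f g 0 = 0,
      forall t u, tensor_map f g (t - u) = tensor_map f g t - tensor_map f g u
    & forall x y, tensor_map f g (pure_tensor x y) = pure_tensor (f x) (g y)].
Proof.
have B t u : tensor_map f g (t - u) = tensor_map f g t - tensor_map f g u.
  exact: lift_is_additive.
split=> // [|x y]; last by rewrite /tensor_map /pure_tensor liftU scale1r.
by rewrite -[X in tensor_map f g X](subrr 0) B subrr.
Qed.

Lemma fiber_tensor_map (A : nuRingType) (M : rmodule A) (N N' : lmodule A) (f : N' -> N)
    (t : {freeg (M * N')%type / int}) x :
  lmod_hom f -> fiber (tensor_map (id : M -> M) f t) x = f (fiber t x).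
Proof.
move=> [fD _]; have [T0 TB Tp] := tensor_map_morph (id : M -> M) f.
have f0 : f 0 = 0 by apply: (addrI (f 0)); rewrite -fD !addr0.
have fN y : f (- y) = - f y by apply: (addrI (f y)); rewrite -fD !subrr.
elim/freeg_int_ind: t => [|t u ht hu|[z y]].
- by rewrite T0 !fiber0 f0.
- by rewrite TB !fiberB ht hu fD fN.
- by rewrite Tp !fiber_pure; case: eqP.
Qed.

Section GradedActions.
Variables (A : nuRingType) (A_ : int -> set A).
Hypothesis dA : is_direct_sum A_.
Variables (M : rmodule A) (M_ : int -> set M).
Hypothesis gM : is_rmodule_grading A_ M_.
Let dM : is_direct_sum M_ := gM.1.

Lemma hcomp_ract_hom d x a g : M_ d x -> hcomp dM (ract x a) g = ract x (hcomp dA a (g - d)).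
Proof.
move=> hx; rewrite {1}(hcomp_sum dA a) ract_sumr hcomp_sumE.
transitivity (\sum_(e <- hsupp dA a) if e == g - d then ract x (hcomp dA a e) else 0).
  apply: eq_bigr => e _; rewrite (hcomp_hom dM g (gM.2 d e x _ hx (hcomp_in dA a e))).
  by rewrite [d + e]addrC -subr_eq eq_sym.
case: (boolP (g - d \in hsupp dA a)) => h.
  rewrite (bigD1_seq (g - d)) ?hsupp_uniq //= eqxx big1 ?addr0 // => e.
  by move/negPf ->.
rewrite (hcomp_out h) ract0r big1_seq // => e /andP[_ eh].
by case: eqP => // ee; rewrite -ee eh in h.
Qed.

Lemma hcomp_ract D x a g : uniq D -> {subset hsupp dM x <= D} ->
  hcomp dM (ract x a) g = \sum_(d <- D) ract (hcomp dM x d) (hcomp dA a (g - d)).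
Proof.
move=> uD sD; rewrite {1}(hcomp_sum_sub uD sD) ract_suml hcomp_sumE.
by apply: eq_bigr => d _; apply: hcomp_ract_hom; exact: hcomp_in.
Qed.
End GradedActions.

(** * Flatness of graded modules *)

Section GradedFlat.
Variables (A : nuRingType) (A_ : int -> set A).
Hypothesis gA : is_graded_ring A_.
Hypothesis regA : forall n x, A_ n x -> regular_in (A_ (- n)) x.
Let dA : is_direct_sum A_ := gA.1.
Let sA n : is_subgroup (A_ n) := direct_sum_subgroup dA n.

(* A matrix [E] whose columns are combinations of the columns [r c] (whence
   the orthogonality to [m]) and which fixes them: a finitely generated
   graded submodule of a graded free module is a direct summand. *)
Lemma homogeneous_projection (M : rmodule A) (J : eqType) (s : seq J) (d : J -> int)
    (m : J -> M) (C : eqType) (cols : seq C) (r : C -> J -> A) (g : C -> int) :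
  uniq s -> (forall c j, c \in cols -> j \in s -> A_ (g c - d j) (r c j)) ->
  (forall c, c \in cols -> \sum_(j <- s) ract (m j) (r c j) = 0) ->
  exists E : J -> J -> A,
    [/\ forall i j, i \in s -> j \in s -> A_ (d j - d i) (E i j),
        forall j, j \in s -> \sum_(i <- s) ract (m i) (E i j) = 0
      & forall c i, c \in cols -> i \in s -> \sum_(j <- s) E i j ** r c j = r c i].
Proof.
move=> us; elim: cols => [|c cols IH] hr mr.
  exists (fun _ _ => 0); split=> // [i j _ _|j _]; first exact: (subgroup0 (sA _)).
  by rewrite big1 // => i _; rewrite ract0r.
have [||E [hE mE rE]] := IH.
- by move=> c' j cc js; apply: hr => //; rewrite inE cc orbT.
- by move=> c' cc; apply: mr; rewrite inE cc orbT.
pose w := r c; pose Ew i := \sum_(j <- s) E i j ** w j.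
pose w' i := w i - Ew i.
have hw i : i \in s -> A_ (g c - d i) (w i) by move=> is_; apply: hr => //; rewrite inE eqxx.
have hw' i : i \in s -> A_ (g c - d i) (w' i).
  move=> is_; apply: (subgroupB (sA _)); first exact: hw.
  apply: (subgroup_sum (sA _)) => j js.
  by apply: (graded_mul gA (hE i j is_ js) (hw j js)); lia.
have [b [hb bE]] := homogeneous_right_unit gA regA us hw'.
(* This is the row b(1-E): the rank-one correction w' b(1-E) vanishes on the columns that E already
   fixes and sends w to w' = (1-E)w. *)
pose bE' j := b j - \sum_(k <- s) b k ** E k j.
have mw : \sum_(i <- s) ract (m i) (w i) = 0 by apply: mr; rewrite inE eqxx.
have mw' : \sum_(i <- s) ract (m i) (w' i) = 0.
  under eq_bigr do rewrite ractBr.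
  rewrite sumrB mw sub0r; apply/eqP; rewrite oppr_eq0; apply/eqP.
  under eq_bigr do rewrite ract_sumr.
  rewrite exchange_big /= big1_seq // => j /andP[_ js].
  under eq_bigr do rewrite ractA.
  by rewrite -ract_suml mE // ract0l.
exists (fun i j => E i j + w' i ** bE' j); split.
- move=> i j is_ js; apply: (subgroupD (sA _)); first exact: hE.
  apply: (@graded_mul _ _ gA (g c - d i) (d j - g c)); first exact: hw'.
    apply: (subgroupB (sA _)); first by rewrite -opprB; exact: hb.
    apply: (subgroup_sum (sA _)) => k ks.
    by apply: (graded_mul gA (hb k ks) (hE k j ks js)); lia.
  by lia.
- move=> j js; under eq_bigr do rewrite ractDr ractA.
  by rewrite big_split /= mE // add0r -ract_suml mw' ract0l.
- have key i (v : J -> A) : i \in s -> \sum_(j <- s) (E i j + w' i ** bE' j) ** v j =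
      \sum_(j <- s) E i j ** v j +
      w' i ** \sum_(k <- s) b k ** (v k - \sum_(j <- s) E k j ** v j).
    move=> is_; under eq_bigr do rewrite numulDl.
    rewrite big_split /=; congr (_ + _); rewrite nu_sumr.
    under eq_bigr do rewrite -numulA.
    rewrite -!nu_sumr; congr (_ ** _).
    under [RHS]eq_bigr do rewrite nuBr.
    rewrite sumrB; under eq_bigr do rewrite nuBl.
    rewrite sumrB; congr (_ - _).
    under eq_bigr do rewrite nu_suml.
    rewrite exchange_big /=; apply: eq_bigr => k _.
    by rewrite nu_sumr; apply: eq_bigr => j _; rewrite numulA.
  move=> c' i; rewrite inE => /orP[/eqP ->|cc] is_; rewrite key //.
    by rewrite bE // /w' addrC subrK.
  rewrite rE // [X in w' i ** X]big1_seq ?nur0 ?addr0 // => k /andP[_ ks].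
  by rewrite rE // subrr nur0.
Qed.

(** Write t as the sum of the m_i (x) u_i. As f(u) is a combination of relation columns fixed by E,
    f(u) = E f(u) = f(Eu), so u = Eu by injectivity. Moving E across the tensor sign replaces m by
    mE = 0. *)
Lemma graded_rmodule_flat (M : rmodule A) (M_ : int -> set M) :
  is_rmodule_grading A_ M_ -> flat_rmodule M.
Proof.
move=> gM N' N f _ uN hf finj t null_t; pose dM : is_direct_sum M_ := gM.1.
have [l [X [hl lE]]] := tensor_null_relations uN null_t.
have [Y hY] := teq_fiber t.
pose S := undup (X ++ Y); have uS : uniq S by exact: undup_uniq.
have sX : {subset X <= S} by move=> x xX; rewrite mem_undup mem_cat xX.
have sY : {subset Y <= S} by move=> x xX; rewrite mem_undup mem_cat xX orbT.
have {}hl := hl S uS sX; have {}hY := hY S uS sY.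
have [fD fA] := hf.
have f0 : f 0 = 0 by apply: (addrI (f 0)); rewrite -fD !addr0.
have f_sum I (q : seq I) (F : I -> N') : f (\sum_(i <- q) F i) = \sum_(i <- q) f (F i).
  exact: (big_morph f fD f0).
pose D := undup (flatten [seq hsupp dM x | x <- S]); have uD : uniq D by exact: undup_uniq.
have sD x : x \in S -> {subset hsupp dM x <= D}.
  by move=> xS d dx; rewrite mem_undup; apply/flatten_mapP; exists x.
(* Each x is split into its components x_d, all of them paired with the same fibre of t at x. *)
pose s := [seq (x, d) | x <- S, d <- D].
have us : uniq s by apply: allpairs_uniq => // -[? ?] [? ?] _ _ [-> ->].
pose m (j : M * int) : M := hcomp dM j.1 j.2.
(* All degrees d + e in which some x r(x) can have a component; for each d in [D] the differences g
   - d then exhaust the degrees of r(x). *)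
pose E0 := undup [seq d + e | d <- D,
  e <- flatten [seq flatten [seq hsupp dA (r.1 x) | x <- S] | r <- l]].
pose cols := [seq (r, g) | r <- l, g <- E0].
(* The column (r,g) is the degree g part of the relation r, hence again a relation, now with
   homogeneous entries. *)
pose rho (c : ((M -> A) * N) * int) (j : M * int) := hcomp dA (c.1.1 j.1) (c.2 - j.2).
have [||E [_ mE rE]] := @homogeneous_projection M _ s (fun j => j.2) m _ cols rho (fun c => c.2) us.
- by move=> c j _ _; exact: hcomp_in.
- move=> c /allpairsP[[r g] [/= rl _ ->]]; rewrite big_allpairs_dep.
  transitivity (hcomp dM (\sum_(x <- S) ract x (r.1 x)) g).
    rewrite hcomp_sumE; apply: eq_big_seq => x xS.
    by rewrite (@hcomp_ract _ _ dA _ _ gM D x (r.1 x) g uD (sD x xS)).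
  by rewrite (hl r rl).2 hcomp0.
pose u (j : M * int) := fiber t j.1.
have fu j : j \in s -> f (u j) = \sum_(c <- cols) lact (rho c j) c.1.2.
  move=> /allpairsP[[x d] [/= xS dD ->]]; rewrite /u -(fiber_tensor_map _ _ hf) lE.
  rewrite /cols big_allpairs_dep; apply: eq_big_seq => r rl.
  rewrite -lact_suml; congr lact; rewrite /rho /=.
  rewrite -(big_map (fun g => g - d) xpredT (hcomp dA (r.1 x))).
  apply: hcomp_sum_sub => [|e er].
    by rewrite map_inj_uniq ?undup_uniq //; exact: addIr.
  apply/mapP; exists (d + e); last by rewrite addrC addKr.
  rewrite mem_undup; apply/allpairsP; exists (d, e); split=> //.
  by apply/flatten_mapP; exists r => //; apply/flatten_mapP; exists x.
have uE i : i \in s -> u i = \sum_(j <- s) lact (E i j) (u j).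
  move=> is_; apply: finj; rewrite f_sum (eq_big_seq (fun j =>
    \sum_(c <- cols) lact (E i j ** rho c j) c.1.2)); last first.
    by move=> j js; rewrite fA fu // lact_sumr; apply: eq_bigr => c _; rewrite lactA.
  rewrite fu // exchange_big /=; apply: eq_big_seq => c cc.
  by rewrite -lact_suml rE.
rewrite -[t]subr0; apply: (teq_trans hY).
apply: (teq_trans (u := \sum_(j <- s) pure_tensor (m j) (u j))).
  rewrite big_allpairs_dep; apply: teq_sum => x xS.
  by rewrite {1}(hcomp_sum_sub uD (sD x xS)); exact: teq_suml.
apply: (teq_trans (u := \sum_(i <- s) \sum_(j <- s) pure_tensor (ract (m i) (E i j)) (u j))).
  apply: teq_sum => i is_; rewrite {1}(uE i is_).
  apply: (teq_trans (u := \sum_(j <- s) pure_tensor (m i) (lact (E i j) (u j)))).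
    exact: teq_sumr.
  by apply: teq_sum => j _; apply: teq_sym; exact: tn_balanced.
rewrite exchange_big /= /teq subr0 big_seq.
apply: (big_ind (@tensor_null A M N')).
- exact: tn_zero.
- by move=> a b; exact: (subgroupD (tensor_null_subgroup M N')).
- move=> j js; rewrite -[X in tensor_null X]subr0.
  apply: (teq_trans (u := pure_tensor (\sum_(i <- s) ract (m i) (E i j)) (u j))).
    by apply: teq_sym; exact: teq_suml.
  by rewrite mE //; apply: teq_sym; exact: teq_pure0l.
Qed.
End GradedFlat.

(** * Left modules as right modules over the opposite ring *)

Section OppositeModules.
Variable A : nuRingType.

Definition lmod_op (N : lmodule A) : rmodule (nuop A) :=
  @RModule (nuop A) N (fun x a => @lact A N a x)
    (fun x y a => @lactDr A N a x y) (fun x a b => @lactDl A N a b x)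
    (fun x a b => @lactA A N b a x).

Definition rmod_op (M : rmodule A) : lmodule (nuop A) :=
  @LModule (nuop A) M (fun a x => @ract A M x a)
    (fun a b x => @ractDr A M x a b) (fun a x y => @ractDl A M x y a)
    (fun a b x => @ractA A M x b a).

Definition tensor_swap (M : rmodule A) (N : lmodule A) :
    {freeg (M * N)%type / int} -> {freeg (lmod_op N * rmod_op M)%type / int} :=
  flift (fun c => @pure_tensor (nuop A) (lmod_op N) (rmod_op M) c.2 c.1).

Definition tensor_unswap (M : rmodule A) (N : lmodule A) :
    {freeg (lmod_op N * rmod_op M)%type / int} -> {freeg (M * N)%type / int} :=
  flift (fun c => @pure_tensor A M N c.2 c.1).

Lemma tensor_swapK M N : cancel (@tensor_swap M N) (@tensor_unswap M N).
Proof.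
elim/freeg_int_ind => [|t u ht hu|[x y]]; rewrite /tensor_swap /tensor_unswap.
- by rewrite !flift0.
- by rewrite !fliftB -/(tensor_unswap _) -/(tensor_unswap _) ht hu.
- by rewrite !flift1.
Qed.

Lemma tensor_null_swap M N t : tensor_null t -> tensor_null (@tensor_swap M N t).
Proof.
elim=> {t} [|t u _ ht _ hu|x x' y|x y y'|x a y]; rewrite /tensor_swap.
- by rewrite flift0; exact: tn_zero.
- by rewrite fliftB; exact: tn_sub.
- by rewrite fliftB fliftD !flift1; exact: tn_addr.
- by rewrite fliftB fliftD !flift1; exact: tn_addl.
- rewrite fliftB !flift1 -opprB; apply: (subgroupN (tensor_null_subgroup _ _)).
  exact: (@tn_balanced (nuop A) (lmod_op N) (rmod_op M)).
Qed.

Lemma tensor_null_unswap M N t : tensor_null t -> tensor_null (@tensor_unswap M N t).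
Proof.
elim=> {t} [|t u _ ht _ hu|x x' y|x y y'|x a y]; rewrite /tensor_unswap.
- by rewrite flift0; exact: tn_zero.
- by rewrite fliftB; exact: tn_sub.
- by rewrite fliftB fliftD !flift1; exact: tn_addr.
- by rewrite fliftB fliftD !flift1; exact: tn_addl.
- rewrite fliftB !flift1 -opprB; apply: (subgroupN (tensor_null_subgroup _ _)).
  exact: (@tn_balanced A M N).
Qed.

Lemma tensor_swap_map (M M' : rmodule A) (N : lmodule A) (f : M' -> M) t :
  @tensor_swap M N (tensor_map f id t) =
  @tensor_map (nuop A) (lmod_op N) (lmod_op N) (rmod_op M') (rmod_op M) id f (tensor_swap t).
Proof.
have [T0 TB T1] := tensor_map_morph f (id : N -> N).
have [U0 UB U1] := @tensor_map_morph (nuop A) (lmod_op N) (lmod_op N)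
  (rmod_op M') (rmod_op M) id f.
elim/freeg_int_ind: t => [|t u ht hu|[x y]]; rewrite /tensor_swap.
- by rewrite T0 !flift0 U0.
- by rewrite TB !fliftB UB -!/(tensor_swap _) ht hu.
- by rewrite T1 !flift1 U1.
Qed.

Lemma flat_lmod_op (N : lmodule A) : flat_rmodule (lmod_op N) -> flat_lmodule N.
Proof.
move=> flatN M' M f uM' uM [fD fA] finj t null_t.
rewrite -[t]tensor_swapK; apply: tensor_null_unswap.
have uop (P : rmodule A) : unital_rmodule P -> unital_lmodule (rmod_op P).
  by move=> uP x; have [l ->] := uP x; exists [seq (c.2, c.1) | c <- l]; rewrite big_map.
apply: (flatN (rmod_op M') (rmod_op M) f (uop _ uM') (uop _ uM)) => //.
  by split=> // a x; exact: fA.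
by rewrite -tensor_swap_map; exact: tensor_null_swap.
Qed.
End OppositeModules.

Lemma graded_lmodule_flat (A : nuRingType) (A_ : int -> set A) :
  is_graded_ring A_ -> (forall n x, A_ n x -> regular_in (A_ (- n)) x) ->
  forall (N : lmodule A) (N_ : int -> set N), is_lmodule_grading A_ N_ -> flat_lmodule N.
Proof.
move=> gA regA N N_ [dN hN]; apply: flat_lmod_op.
apply: (@graded_rmodule_flat (nuop A) A_ (is_graded_ring_op gA) _ (lmod_op N) N_).
  by move=> n x /regA; move/regular_op.
by split=> // m n x a hx ha; rewrite addrC; exact: hN.
Qed.

(** * Quotient modules and maximal submodules *)

Section ZmodQuotient.
Variables (V : zmodType) (U : set V).
Hypothesis hU : is_subgroup U.

Definition subgroup_pred : {pred V} := fun x => `[< U x >].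

Fact subgroup_pred_closed : zmod_closed subgroup_pred.
Proof.
split=> [|x y]; first by apply/asboolP; exact: subgroup0.
by move=> /asboolP Ux /asboolP Uy; apply/asboolP; exact: subgroupB.
Qed.
HB.instance Definition _ := GRing.isZmodClosed.Build V subgroup_pred subgroup_pred_closed.

Lemma zmod_quotient : exists (Q : zmodType) (pi : V -> Q) (sec : Q -> V),
  [/\ forall x y, pi (x + y) = pi x + pi y, cancel sec pi & forall x, pi x = 0 <-> U x].
Proof.
pose Q := Quotient.quot (subgroup_pred : zmodClosed V).
exists Q, (fun x => \pi_Q%qT x), (fun q => repr q); split.
- by move=> x y; rewrite !piE.
- by move=> q; exact: reprK.
- move=> x; have -> : (0 : Q) = \pi_Q%qT 0 by rewrite !piE.
  have := Quotient.idealrBE (subgroup_pred : zmodClosed V) x 0.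
  rewrite subr0 => xE; split=> [/eqP|/asboolP Ux].
    by rewrite -xE => /asboolP.
  by apply/eqP; rewrite -xE.
Qed.
End ZmodQuotient.

Section ModuleQuotient.
Variable A : nuRingType.

Definition regular_rmodule : rmodule A :=
  @RModule A A (fun x a => x ** a) (@numulDl A) (@numulDr A) (@numulA A).

Lemma rmodule_quotient (M : rmodule A) (U : set M) : rsubmodule U ->
  exists (Q : rmodule A) (pi : M -> Q) (sec : Q -> M),
    [/\ rmod_hom pi, cancel sec pi & forall x, pi x = 0 <-> U x].
Proof.
move=> [hU mU]; have [Q [pi [sec [piD secK pi0]]]] := zmod_quotient hU.
have p0 : pi 0 = 0 by apply: (addrI (pi 0)); rewrite -piD !addr0.
have piN x : pi (- x) = - pi x by apply: (addrI (pi x)); rewrite -piD !subrr.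
have piA x a : pi (ract (sec (pi x)) a) = pi (ract x a).
  apply/eqP; rewrite -subr_eq0 -piN -piD -ractBl; apply/eqP/pi0; apply: mU.
  by apply/pi0; rewrite piD piN secK subrr.
pose act (q : Q) (a : A) := pi (ract (sec q) a).
have actDl x y a : act (x + y) a = act x a + act y a.
  by rewrite -(secK x) -(secK y) -piD /act !piA ractDl piD.
have actDr x a b : act x (a + b) = act x a + act x b by rewrite /act ractDr piD.
have actA x a b : act x (a ** b) = act (act x a) b by rewrite /act piA ractA.
exists (RModule actDl actDr actA), pi, sec; split=> //; split=> // x a.
by rewrite /= /act piA.
Qed.

(** The second hypothesis says that A acts nontrivially on the quotient, which maximality of U alone
    does not give without a unit. *)
Lemma rmodule_quotient_simple (M : rmodule A) (U : set M) :
  rsubmodule U -> (exists x (a : A), ~ U (ract x a)) ->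
  (forall W, rsubmodule W -> U `<=` W -> W = U \/ W = setT) ->
  exists (Q : rmodule A) (pi : M -> Q),
    [/\ simple_rmodule Q, rmod_hom pi & forall x, pi x = 0 <-> U x].
Proof.
move=> sU [x0 [a0 xa0]] maxU; have [Q [pi [sec [[piD piA] secK pi0]]]] := rmodule_quotient sU.
have p0 : pi 0 = 0 by apply: (addrI (pi 0)); rewrite -piD !addr0.
have piN x : pi (- x) = - pi x by apply: (addrI (pi x)); rewrite -piD !subrr.
exists Q, pi; split=> //; split.
  by exists (pi x0), a0; rewrite -piA => /pi0.
move=> W [hW mW].
have sW : rsubmodule [set x | W (pi x)].
  split; first split=> [|x y /= Wx Wy]; first by rewrite /= p0; exact: subgroup0.
    by rewrite piD piN; exact: (subgroupB hW).
  by move=> x a /= Wx; rewrite piA; exact: mW.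
have UW : U `<=` [set x | W (pi x)] by move=> x /pi0 /= ->; exact: (subgroup0 hW).
have [WE|WE] := maxU _ sW UW; [left|right]; apply/seteqP; split=> // q.
- by rewrite -[q]secK => Wq; apply/pi0; rewrite -WE.
- by move=> ->; exact: (subgroup0 hW).
- by move=> _; rewrite -[q]secK; have : [set x | W (pi x)] (sec q) by rewrite WE.
Qed.
End ModuleQuotient.

Lemma zorn_avoiding (T : Type) (Q : set (set T)) (W0 : set T) (x0 : T) :
  (forall F : set (set T), F !=set0 -> F `<=` Q -> total_on F subset ->
     Q (\bigcup_(W in F) W)) ->
  Q W0 -> ~ W0 x0 ->
  exists W, [/\ Q W, W0 `<=` W, ~ W x0 &
    forall W', Q W' -> W `<=` W' -> ~ W' x0 -> W' = W].
Proof.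
move=> Qcup QW0 W0x.
(* [Zorn_bigcup] also demands the union of the empty chain; joining [W0] to every set makes that
   union stand for [W0] itself. *)
pose P : set (set T) := [set B | Q (W0 `|` B) /\ ~ (W0 `|` B) x0].
have Pcup F : F `<=` P -> total_on F subset -> P (\bigcup_(X in F) X).
  move=> FP totF; have [->|/set0P[X FX]] := eqVneq F set0.
    by rewrite bigcup_set0; split; rewrite setU0.
  have E : W0 `|` \bigcup_(B in F) B = \bigcup_(W in [set W0 `|` B | B in F]) W.
    apply/seteqP; split=> [x [W0x'|[B FB Bx]]|x [_ [B FB <-]] [W0x'|Bx]].
    - by exists (W0 `|` X); [exists X|left].
    - by exists (W0 `|` B); [exists B|right].
    - by left.
    - by right; exists B.
  split; rewrite E.
    apply: Qcup.
    - by exists (W0 `|` X), X.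
    - by move=> _ [B /FP[QB _] <-].
    - move=> _ _ [B FB <-] [C FC <-].
      by have [BC|CB] := totF B C FB FC; [left|right]; apply: setUS.
  by move=> [_ [B FB <-]]; case: (FP B FB).
have [B [[QB xB] maxB]] := Zorn_bigcup Pcup.
exists (W0 `|` B); split=> // W' QW' BW' xW'.
apply: contrapT => neq.
have W0W' : W0 `|` W' = W' by apply: setUidr; exact: (subset_trans (@subsetUl _ W0 B) BW').
apply: (maxB W').
  rewrite properEneq; split; last by move=> x Bx; apply: BW'; right.
  by apply/eqP => BE; apply: neq; rewrite BE.
by split; rewrite W0W'.
Qed.

Lemma rsubmodule_bigcup (A : nuRingType) (M : rmodule A) (F : set (set M)) :
  F !=set0 -> F `<=` @rsubmodule A M -> total_on F subset ->
  rsubmodule (\bigcup_(W in F) W).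
Proof.
move=> [W0 FW0] FQ totF; split; first split.
- by exists W0 => //; exact: (subgroup0 (FQ W0 FW0).1).
- move=> x y [W FW Wx] [W' FW' W'y].
  have [WW'|W'W] := totF W W' FW FW'.
    by exists W' => //; apply: (subgroupB (FQ W' FW').1) => //; exact: WW'.
  by exists W => //; apply: (subgroupB (FQ W FW).1) => //; exact: W'W.
- by move=> x a [W FW Wx]; exists W => //; exact: (FQ W FW).2.
Qed.

(** * Jacobson radicals *)

Lemma int_seq_min (s : seq int) : s != [::] -> exists2 m, m \in s & forall n, n \in s -> m <= n.
Proof.
elim: s => // k [|l s] IH _; first by exists k; rewrite ?inE // => n; rewrite inE => /eqP ->.
have [m ms mE] := IH isT; case: (lerP k m) => [km|/ltW mk].
  exists k; first by rewrite inE eqxx.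
  by move=> n; rewrite inE => /orP[/eqP -> //|/mE]; exact: le_trans.
exists m; first by rewrite inE ms orbT.
by move=> n; rewrite inE => /orP[/eqP -> //|]; exact: mE.
Qed.

Lemma int_seq_max (s : seq int) : s != [::] -> exists2 m, m \in s & forall n, n \in s -> n <= m.
Proof.
move=> s0; have [|m] := @int_seq_min [seq - n | n <- s]; first by case: (s) s0.
case/mapP=> k ks -> h; exists k => // n ns; rewrite -lerN2; apply: h; exact: map_f.
Qed.

(** * Maximal submodules of a graded simple module *)

Section GradedSimple.
Variables (A : nuRingType) (A_ : int -> set A).
Hypothesis gA : is_graded_ring A_.
Let dA : is_direct_sum A_ := gA.1.
Variables (M : rmodule A) (M_ : int -> set M).
Hypothesis gM : is_rmodule_grading A_ M_.
Let dM : is_direct_sum M_ := gM.1.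

Lemma hcomp_ract_homr k x a g : A_ k a -> hcomp dM (ract x a) g = ract (hcomp dM x (g - k)) a.
Proof.
move=> ha; rewrite {1}(hcomp_sum dM x) ract_suml hcomp_sumE.
transitivity (\sum_(e <- hsupp dM x) if e == g - k then ract (hcomp dM x e) a else 0).
  apply: eq_bigr => e _; rewrite (hcomp_hom dM g (gM.2 e k _ a (hcomp_in dM x e) ha)).
  by rewrite -subr_eq eq_sym.
case: (boolP (g - k \in hsupp dM x)) => h.
  rewrite (bigD1_seq (g - k)) ?hsupp_uniq //= eqxx big1 ?addr0 // => e.
  by move/negPf ->.
rewrite (hcomp_out h) ract0l big1_seq // => e /andP[_ eh].
by case: eqP => // ee; rewrite -ee eh in h.
Qed.

Lemma hcomp_ract_split x a g :
  hcomp dM (ract x a) g = \sum_(k <- hsupp dA a) ract (hcomp dM x (g - k)) (hcomp dA a k).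
Proof.
rewrite {1}(hcomp_sum dA a) ract_sumr hcomp_sumE.
by apply: eq_bigr => k _; apply: hcomp_ract_homr; exact: hcomp_in.
Qed.

Lemma hcomp_eq0 x : (forall n, hcomp dM x n = 0) -> x = 0.
Proof. by move=> h; rewrite (hcomp_sum dM x) big1. Qed.

Lemma hcomp_neq0 x : x <> 0 -> exists n, hcomp dM x n <> 0.
Proof.
move=> x0; apply: contrapT => /forallNP h; apply: x0; apply: hcomp_eq0 => n.
exact: contrapT (h n).
Qed.

Lemma cyclic_submodule x : rsubmodule [set z : M | exists a, z = ract x a].
Proof.
split; first split=> [|_ _ [a ->] [b ->]]; first by exists 0; rewrite ract0r.
  by exists (a - b); rewrite ractBr.
by move=> _ b [a ->]; exists (a ** b); rewrite ractA.
Qed.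

Hypothesis simpleM : graded_simple_rmodule A_ M_.

(** xA is a graded submodule. Were it 0, x would lie in the graded submodule of elements killed by
    A, which would then be all of M, against the nontrivial action. *)
Lemma graded_simple_cyclic n x : M_ n x -> x <> 0 -> forall z, exists a, z = ract x a.
Proof.
move=> hx x0; have [_ [x1 [a1 xa1]] simp] := simpleM.
pose Z := [set z : M | forall a, ract z a = 0].
have sZ : rsubmodule Z.
  split; first split=> [a|y z Zy Zz a]; first exact: ract0l.
    by rewrite ractBl Zy Zz subr0.
  by move=> z a Zz b; rewrite -ractA Zz.
have gZ : is_graded_subset M_ Z.
  apply: (@hcomp_graded _ _ dM) => z m Zz a.
  rewrite (hcomp_sum dA a) ract_sumr big1 // => k _.
  have := hcomp_ract_homr z (m + k) (hcomp_in dA a k).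
  by rewrite Zz hcomp0 addrK.
have gx : is_graded_subset M_ [set z : M | exists a, z = ract x a].
  apply: (@hcomp_graded _ _ dM) => _ m [a ->]; exists (hcomp dA a (m - n)).
  exact: (hcomp_ract_hom dA gM).
have [E|E] := simp _ (cyclic_submodule x) gx; last first.
  by move=> z; have : [set z : M | exists a, z = ract x a] z by rewrite E.
have Zx : Z x.
  move=> a; have : [set z : M | exists a, z = ract x a] (ract x a) by exists a.
  by rewrite E.
have [ZE|ZE] := simp Z sZ gZ; first by move: Zx; rewrite ZE.
by exfalso; apply: xa1; have : Z x1 by rewrite ZE.
Qed.

Definition maximal_rsubmodule (W : set M) : Prop :=
  [/\ rsubmodule W, W <> setT & forall W', rsubmodule W' -> W `<=` W' -> W' = W \/ W' = setT].

Lemma graded_simple_homogeneous : exists n x, M_ n x /\ x <> 0.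
Proof.
have [_ [x [a xa]] _] := simpleM.
have x0 : x <> 0 by move=> x0; apply: xa; rewrite x0 ract0l.
have [n xn] := hcomp_neq0 x0; exists n, (hcomp dM x n); split=> //; exact: hcomp_in.
Qed.

(** A nonzero homogeneous x generates M, so the proper submodules are exactly those avoiding x, and
    Zorn's lemma applies to them. *)
Lemma maximal_rsubmodule_exists W : rsubmodule W -> W <> setT ->
  exists2 W', maximal_rsubmodule W' & W `<=` W'.
Proof.
move=> sW WT; have [n [x [hx x0]]] := graded_simple_homogeneous.
have xT W' : rsubmodule W' -> W' x -> W' = setT.
  move=> [_ mW'] W'x; apply/seteqP; split=> // z _.
  by have [a ->] := graded_simple_cyclic hx x0 z; exact: mW'.
have Wx : ~ W x by move=> /(xT W sW).
have [W' [sW' WW' W'x maxW']] := zorn_avoiding (@rsubmodule_bigcup A M) sW Wx.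
exists W' => //; split=> // [W'T|V sV W'V]; first by apply: W'x; rewrite W'T.
by have [/(xT V sV)|Vx] := pselect (V x); [right | left; exact: maxW'].
Qed.

Lemma jacobson_radical_maximal a W x : jacobson_radical A a ->
  maximal_rsubmodule W -> W (ract x a).
Proof.
move=> Ja [sW WT maxW]; have [n [y [hy y0]]] := graded_simple_homogeneous.
have [|Q [pi [simQ [_ piA] pi0]]] := rmodule_quotient_simple sW _ maxW.
  apply: contrapT => h; apply: WT; apply/seteqP; split=> // z _.
  have [b ->] := graded_simple_cyclic hy y0 z.
  by apply: contrapT => Wyb; apply: h; exists y, b.
by apply/pi0; rewrite piA; exact: Ja.
Qed.

(** The exact support: an argument by minimal length cannot use [hsupp], which may list zero
    components. *)
Definition msupp (x : M) : seq int := [seq n <- hsupp dM x | hcomp dM x n != 0].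

Lemma mem_msupp x n : (n \in msupp x) = (hcomp dM x n != 0).
Proof.
rewrite mem_filter; case: (boolP (n \in hsupp dM x)) => [|/hcomp_out ->].
  by rewrite andbT.
by rewrite eqxx.
Qed.

Lemma msupp_uniq x : uniq (msupp x).
Proof. by apply: filter_uniq; exact: hsupp_uniq. Qed.

(* Let [u] be a nonzero element of the intersection of minimal
   length, with lowest and highest terms [u_a] and [u_b]; by minimality
   [u_i c = 0] implies [u c = 0] for homogeneous [c].  Writing [u_b = u_a c']
   and [w = u_a - u c'], no maximal submodule contains [w], so [u_a = w c];
   but the lowest and highest terms of [w] have different degrees and
   the same annihilator, so that [w c] is not homogeneous. *)
Lemma maximal_rsubmodules_meet u :
  (forall W, maximal_rsubmodule W -> W u) -> u = 0.
Proof.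
pose U := [set u | forall W, maximal_rsubmodule W -> W u].
have UB y z : U y -> U z -> U (y - z).
  by move=> Uy Uz W mW; have [[hW _] _ _] := mW; apply: (subgroupB hW); [exact: Uy|exact: Uz].
have Ua y c : U y -> U (ract y c).
  by move=> Uy W mW; have [[_ hW] _ _] := mW; apply: hW; exact: Uy.
move=> Uu; apply: contrapT => u0; have {Uu} Uu : U u by [].
pose P n := `[< exists v, [/\ U v, v <> 0 & size (msupp v) = n] >].
have exP : exists n, P n by exists (size (msupp u)); apply/asboolP; exists u.
case: (ex_minnP exP) => N /asboolP[{Uu u0} {}u [Uu u0 uN]] minN.
have small v : U v -> (size (msupp v) < size (msupp u))%N -> v = 0.
  move=> Uv sv; apply: contrapT => v0; have := minN (size (msupp v)).
  by rewrite leqNgt -uN sv => /(_ _)/negP; apply=> //; apply/asboolP; exists v.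
have ann k c i : A_ k c -> i \in msupp u -> ract (hcomp dM u i) c = 0 -> ract u c = 0.
  move=> hc iu ic; apply: small; first exact: Ua.
  (* Multiplication by c shifts degrees by k and loses the term of degree i, so uc is shorter than u
     and vanishes by minimality. *)
  have sub : {subset [seq n - k | n <- msupp (ract u c)] <= rem i (msupp u)}.
    move=> _ /mapP[n nc ->]; rewrite (mem_rem_uniq _ (msupp_uniq u)) inE.
    move: nc; rewrite !mem_msupp (hcomp_ract_homr _ _ hc) => nc; apply/andP; split.
      by apply: contra nc => /eqP ->; rewrite ic.
    by apply: contra nc => /eqP ->; rewrite ract0l.
  rewrite -(size_map (fun n => n - k)); apply: (leq_ltn_trans (uniq_leq_size _ sub)).
    by rewrite map_inj_uniq ?msupp_uniq //; exact: addIr.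
  by rewrite size_rem // prednK // -has_predT; apply/hasP; exists i.
have annc k c j : A_ k c -> ract u c = 0 -> ract (hcomp dM u j) c = 0.
  by move=> hc uc; rewrite -[j](addrK k) -(hcomp_ract_homr _ _ hc) uc hcomp0.
have su : msupp u != [::].
  have [n un] := hcomp_neq0 u0; apply/eqP => h.
  by have := mem_msupp u n; rewrite h in_nil => /esym/negbFE/eqP.
have [a au amin] := int_seq_min su; have [b bu bmax] := int_seq_max su.
have uout n : n \notin msupp u -> hcomp dM u n = 0 by rewrite mem_msupp negbK => /eqP.
have ua0 : hcomp dM u a <> 0 by move: au; rewrite mem_msupp => /eqP.
have cyc := graded_simple_cyclic (hcomp_in dM u a) ua0.
(* One maximal submodule makes the intersection proper, so it cannot contain u_a, which generates
   M. *)
have [W1 mW1 _] : exists2 W1, maximal_rsubmodule W1 & [set 0] `<=` W1.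
  apply: maximal_rsubmodule_exists.
    split; first by split=> // x y -> ->; rewrite subrr.
    by move=> x c ->; rewrite ract0l.
  by move=> h; apply: u0; have : [set: M] u by []; rewrite -h.
have Uhom : ~ U (hcomp dM u a).
  move=> Uua; have [_ WT _] := mW1; apply: WT; apply/seteqP; split=> // z _.
  by have [c ->] := cyc z; apply: Ua.
have ab : a < b.
  rewrite lt_neqAle amin // andbT; apply/eqP => ab; apply: Uhom.
  rewrite (_ : hcomp dM u a = u) // [RHS](hcomp_sum dM u).
  have [ha|] := boolP (a \in hsupp dM u); last first.
    by move=> ha; case: ua0; rewrite hcomp_out.
  rewrite (bigD1_seq a) ?hsupp_uniq //= big1 ?addr0 // => n na.
  apply: uout; apply/negP => nu; case/eqP: na; apply: le_anti.
  by rewrite amin // andbT ab bmax.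
have [c0 c0E] := cyc (hcomp dM u b); pose d := b - a; pose c' := hcomp dA c0 d.
have hc' : A_ d c' by exact: hcomp_in.
have ubE : hcomp dM u b = ract (hcomp dM u a) c'.
  rewrite /c' /d -(hcomp_ract_hom dA gM c0 b (hcomp_in dM u a)) -c0E.
  by rewrite (hcomp_hom dM b (hcomp_in dM u b)) eqxx.
have ub0 : hcomp dM u b <> 0 by move: bu; rewrite mem_msupp => /eqP.
pose w := hcomp dM u a - ract u c'.
have wE n : hcomp dM w n = (if n == a then hcomp dM u a else 0) - ract (hcomp dM u (n - d)) c'.
  by rewrite /w hcompB (hcomp_hom dM n (hcomp_in dM u a)) (hcomp_ract_homr _ _ hc').
have [c cE] : exists c, hcomp dM u a = ract w c.
  suff : [set z : M | exists c, z = ract w c] = setT.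
    by move=> h; have : [set z : M | exists c, z = ract w c] (hcomp dM u a) by rewrite h.
  apply: contrapT => WT.
  have [W mW wW] := maximal_rsubmodule_exists (cyclic_submodule w) WT.
  have [[hW _] WT' _] := mW; apply: WT'; apply/seteqP; split=> // z _.
  have [e ->] := cyc z.
  rewrite -[hcomp dM u a](subrK (ract u c')) ractDl; apply: (subgroupD hW).
    by apply: wW; exists e.
  exact: (Ua _ _ (Ua _ _ Uu) W mW).
have wann k e : A_ k e -> ract (hcomp dM u a) e = 0 -> forall n, ract (hcomp dM w n) e = 0.
  move=> he uae n; have ue := ann k e a he au uae.
  have uce : ract u (c' ** e) = 0.
    by apply: (ann (d + k) _ a _ au); [exact: gA.2 | rewrite ractA -ubE; exact: (annc k e b he ue)].
  rewrite wE ractBl -ractA (annc (d + k) _ _ _ uce) ?subr0; last exact: gA.2.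
  by case: eqP => _; rewrite ?ract0l.
(* A component of c that kills u_a kills every component of w, so only these degrees contribute to
   wc. *)
pose s := [seq k <- hsupp dA c | ract (hcomp dM u a) (hcomp dA c k) != 0].
have hck k : A_ k (hcomp dA c k) by exact: hcomp_in.
have wcE g : hcomp dM (ract w c) g =
    \sum_(k <- s) ract (hcomp dM w (g - k)) (hcomp dA c k).
  rewrite hcomp_ract_split /s big_filter [RHS]big_mkcond /=; apply: eq_bigr => k _.
  by case: eqP => //= uk; rewrite (wann k).
have us : uniq s by apply: filter_uniq; exact: hsupp_uniq.
have s0 : s != [::].
  apply/eqP => s0; apply: ua0; rewrite cE; apply: hcomp_eq0 => g.
  by rewrite wcE s0 big_nil.
have [k0 k0s k0min] := int_seq_min s0; have [k1 k1s k1max] := int_seq_max s0.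
have us0 k : k \in s -> ract (hcomp dM u a) (hcomp dA c k) <> 0.
  by rewrite mem_filter => /andP[/eqP].
have ulow n : n < a -> hcomp dM u n = 0.
  by move=> na; apply: uout; apply/negP => /amin; rewrite leNgt na.
have uhigh n : b < n -> hcomp dM u n = 0.
  by move=> na; apply: uout; apply/negP => /bmax; rewrite leNgt na.
(* The support of w runs from a, with term u_a, to b + d, with term -u_b c'. The lowest term of wc
   is therefore u_a c_k0. *)
have low : hcomp dM (ract w c) (a + k0) <> 0.
  rewrite wcE (bigD1_seq k0) //= big1_seq ?addr0; last first.
    move=> k /andP[kk0 ks]; have kk := k0min k ks.
    rewrite wE (ulow (a + k0 - k - d)) ?ract0l ?subr0; last by rewrite /d; lia.
    by case: eqP => [kE|_]; [exfalso; move/eqP: kk0; apply; lia | rewrite ract0l].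
  rewrite addrK wE eqxx (ulow (a - d)) ?ract0l ?subr0; last by rewrite /d; lia.
  exact: us0.
(* If u_b c' c_k1 = 0, then u c' c_k1 = 0, so u_b c_k1 = u_a c' c_k1 = 0, hence u c_k1 = 0 and u_a
   c_k1 = 0, against the choice of k1. *)
have high : hcomp dM (ract w c) (b + d + k1) <> 0.
  rewrite wcE (bigD1_seq k1) //= big1_seq ?addr0; last first.
    move=> k /andP[kk1 ks]; have kk := k1max k ks; have {}kk1 : k <> k1 by apply/eqP.
    rewrite wE (uhigh (b + d + k1 - k - d)) ?ract0l ?subr0; last by lia.
    by case: eqP => [kE|_]; [exfalso; move: kE; rewrite /d; lia | rewrite ract0l].
  rewrite addrK wE addrK; case: eqP => [|_]; first by rewrite /d; lia.
  rewrite sub0r ractNl => /eqP; rewrite oppr_eq0 -ractA => /eqP ubk.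
  have uk := ann (d + k1) _ b (gA.2 _ _ _ _ hc' (hck k1)) bu ubk.
  have := annc (d + k1) _ a (gA.2 _ _ _ _ hc' (hck k1)) uk.
  rewrite ractA -ubE => ubk1; apply: (us0 k1 k1s).
  exact: (annc k1 _ a (hck k1) (ann k1 _ b (hck k1) bu ubk1)).
have E g : hcomp dM (ract w c) g = if g == a then hcomp dM u a else 0.
  by rewrite -cE (hcomp_hom dM g (hcomp_in dM u a)).
(* As wc = u_a lives in degree a alone, a + k0 = a and b + d + k1 = a; but k1 >= k0 = 0, d > 0 and b
   > a. *)
have k0E : k0 = 0.
  by apply: contrapT => k00; apply: low; rewrite E; case: eqP => //; lia.
apply: high; rewrite E; case: eqP => //; have := k0min k1 k1s; rewrite k0E /d; lia.
Qed.

Lemma jacobson_radical_graded_simple a x : jacobson_radical A a -> ract x a = 0 :> M.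
Proof.
by move=> Ja; apply: maximal_rsubmodules_meet => W mW; exact: jacobson_radical_maximal.
Qed.
End GradedSimple.

Lemma jacobson_radical_sub (A : nuRingType) (A_ : int -> set A) :
  is_graded_ring A_ -> jacobson_radical A `<=` graded_jacobson_radical A_.
Proof.
move=> gA a Ja M M_ simpM x; have [gM _ _] := simpM.
exact: (jacobson_radical_graded_simple gA gM simpM).
Qed.

(** * Vanishing of the graded Jacobson radical *)

Section GradedJacobson.
Variables (A : nuRingType) (A_ : int -> set A).
Hypothesis gA : is_graded_ring A_.
Hypothesis regA : forall n x, A_ n x -> regular_in (A_ (- n)) x.
Let dA : is_direct_sum A_ := gA.1.

(** For x homogeneous of degree d, x a_n is the component of degree d + n of xa = 0. *)
Lemma graded_jacobson_hcomp a n : graded_jacobson_radical A_ a ->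
  graded_jacobson_radical A_ (hcomp dA a n).
Proof.
move=> Ja M M_ simpM x; have [gM _ _] := simpM.
rewrite (hcomp_sum gM.1 x) ract_suml big1 // => d _.
have := hcomp_ract_hom dA gM a (d + n) (hcomp_in gM.1 x d).
by rewrite (Ja M M_ simpM) hcomp0 [d + n]addrC addrK.
Qed.

Definition regular_grading : is_rmodule_grading A_ (M := regular_rmodule A) A_ := gA.

(** The module is A/U. A graded right ideal strictly above U contains e, hence every a = (a - ea) +
    ea; and the class of e is fixed by e, so the action is nontrivial. *)
Lemma graded_simple_quotient (U : set A) (e : A) :
  graded_right_ideal A_ U -> A_ 0 e -> ~ U e -> e ** e = e ->
  (forall a, U (a - e ** a)) ->
  (forall W, graded_right_ideal A_ W -> U `<=` W -> ~ W e -> W = U) ->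
  exists (M : rmodule A) (M_ : int -> set M) (x : M),
    graded_simple_rmodule A_ M_ /\ ract x e <> 0.
Proof.
move=> [[hU mU] gU] he Ue ee Uea maxU.
have [Q [pi [sec [[piD piA] secK pi0]]]] := @rmodule_quotient A (regular_rmodule A) U (conj hU mU).
have p0 : pi 0 = 0 by apply: (addrI (pi 0)); rewrite -piD !addr0.
have piN x : pi (- x) = - pi x by apply: (addrI (pi x)); rewrite -piD !subrr.
have pi_sum I (r : seq I) (F : I -> A) : pi (\sum_(i <- r) F i) = \sum_(i <- r) pi (F i).
  exact: (big_morph pi piD p0).
pose Q_ n := [set pi x | x in A_ n].
have piE (q : Q) : exists x : A, q = pi x by exists (sec q); rewrite secK.
have gQ : is_rmodule_grading A_ Q_.
  split; last first.
    move=> m n _ a [x hx <-] ha; exists (x ** a); first exact: gA.2.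
    exact: piA.
  split.
  - move=> n; split=> [|_ _ [x hx <-] [y hy <-]].
      by exists 0 => //; exact: (subgroup0 (direct_sum_subgroup dA n)).
    exists (x - y); first exact: (subgroupB (direct_sum_subgroup dA n)).
    by rewrite piD piN.
  - move=> q; have [x ->] := piE q; exists (hsupp dA x), (fun n => pi (hcomp dA x n)).
    split; first by move=> n; exists (hcomp dA x n) => //; exact: hcomp_in.
    by rewrite -pi_sum -hcomp_sum.
  - move=> s c us hc c0 n ns.
    (* The lifts are homogeneous and their sum lies in U; as U is graded, each lift lies in U, so
       each c n is 0. *)
    have /choice[d hd] : forall n, exists x, A_ n x /\ pi x = c n.
      by move=> m; have [x hx xE] := hc m; exists x.
    have -> : c n = pi (hcomp dA (\sum_(m <- s) d m) n).
      rewrite -(hd n).2 hcomp_sumE (bigD1_seq n) //= big1 ?addr0.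
        by rewrite (hcomp_hom dA n (hd n).1) eqxx.
      by move=> m mn; rewrite (hcomp_hom dA n (hd m).1) eq_sym (negPf mn).
    apply/pi0; apply: (@graded_hcomp _ _ dA U hU gU); apply/pi0; rewrite pi_sum.
    by under eq_bigr do rewrite (hd _).2.
have pee : ract (pi e) e <> 0.
  by rewrite -piA /= => /pi0; rewrite /= ee.
exists Q, Q_, (pi e); split=> //; split=> //; first by exists (pi e), e.
move=> W [hW mW] gW; pose W' := [set x : A | W (pi x)].
have sW' : graded_right_ideal A_ W'.
  split; first split.
  - split=> [|x y Wx Wy]; first by rewrite /W' /= p0; exact: (subgroup0 hW).
    by rewrite /W' /= piD piN; exact: (subgroupB hW).
  - by move=> x a Wx; rewrite /W' /= (piA x a); exact: mW.
  - apply: (@hcomp_graded _ _ dA) => x n Wx.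
    have -> : W' (hcomp dA x n) = W (hcomp gQ.1 (pi x) n).
      rewrite {2}(hcomp_sum dA x) pi_sum hcomp_sumE /W' /=; congr W.
      transitivity (\sum_(m <- hsupp dA x) if m == n then pi (hcomp dA x m) else 0); last first.
        apply: eq_bigr => m _; rewrite (hcomp_hom gQ.1 n (n := m)) 1?eq_sym //.
        by exists (hcomp dA x m) => //; exact: hcomp_in.
      case: (boolP (n \in hsupp dA x)) => h.
        by rewrite (bigD1_seq n) ?hsupp_uniq //= eqxx big1 ?addr0 // => m /negPf ->.
      rewrite hcomp_out // p0 big1_seq // => m /andP[_ mx].
      by case: eqP => // mn; rewrite -mn mx in h.
    exact: (@graded_hcomp _ _ gQ.1 W hW gW).
have UW' : U `<=` W' by move=> x Ux; rewrite /W' /=; move/pi0: Ux => ->; exact: (subgroup0 hW).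
have [W'e|W'e] := pselect (W' e); [right|left]; apply/seteqP; split=> // q.
- move=> _; have [x ->] := piE q; rewrite -(subrK (e ** x) x) piD; apply: (subgroupD hW).
    by move/pi0: (Uea x) => ->; exact: (subgroup0 hW).
  by rewrite (piA e x); exact: mW.
- have [x ->] := piE q => Wx; apply/pi0; rewrite -(maxU W' sW' UW' W'e); exact: Wx.
- by move=> ->; exact: (subgroup0 hW).
Qed.

Lemma graded_jacobson_radical0 : graded_jacobson_radical A_ = [set 0].
Proof.
apply/seteqP; split=> [a Ja|_ -> M M_ _ x]; last by rewrite ract0r.
rewrite /= (hcomp_sum dA a) big1 // => n _.
have [y hy yE] := regA (hcomp_in dA a n).
have Jan := graded_jacobson_hcomp n Ja.
set b := hcomp dA a n in yE Jan *; pose e := b ** y.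
have he : A_ 0 e by apply: (graded_mul gA (hcomp_in dA a n) hy); rewrite subrr.
have ee : e ** e = e by rewrite /e numulA -yE.
apply: contrapT => b0.
have e0 : e <> 0 by move=> e0; apply: b0; rewrite yE -/e e0 nu0r.
(* Formally (1-e)A, which is killed by e on the left and so misses e = ee. *)
pose W0 := [set z : A | exists x, z = x - e ** x].
have gW0 : graded_right_ideal A_ W0.
  split; first split; first split.
  - by exists 0; rewrite nur0 subr0.
  - move=> _ _ [u ->] [v ->]; exists (u - v).
    by rewrite nuBr !opprB addrACA [RHS]addrACA [- v - _]addrC.
  - by move=> _ v [u ->]; exists (u ** v); rewrite nuBl numulA.
  - apply: (@hcomp_graded _ _ dA) => _ m [u ->]; exists (hcomp dA u m).
    rewrite hcompB; congr (_ - _).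
    have := hcomp_ract_hom dA regular_grading u m he.
    by rewrite subr0.
have W0e : ~ W0 e.
  move=> [u uE]; apply: e0; rewrite -ee {2}uE nuBr numulA ee subrr //.
have cup (F : set (set A)) : F !=set0 -> F `<=` graded_right_ideal A_ -> total_on F subset ->
    graded_right_ideal A_ (\bigcup_(W in F) W).
  move=> F0 FQ totF; split.
    by apply: (@rsubmodule_bigcup A (regular_rmodule A)) => // W /FQ[].
  move=> x [W FW Wx]; have [_ gW] := FQ W FW; have [s [c [hc ->]]] := gW x Wx.
  by exists s, c; split=> // m; have [hm Wm] := hc m; split=> //; exists W.
have [U [gU W0U Ue maxU]] := zorn_avoiding cup gW0 W0e.
have [|M [M_ [x [simpM]]]] := graded_simple_quotient gU he Ue ee _ maxU.
  by move=> u; apply: W0U; exists u.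
by apply; rewrite /e ractA (Jan M M_ simpM) ract0l.
Qed.

Lemma jacobson_radicals :
  jacobson_radical A = graded_jacobson_radical A_ /\ graded_jacobson_radical A_ = [set 0].
Proof.
split; last exact: graded_jacobson_radical0.
apply/seteqP; split; first exact: jacobson_radical_sub.
by rewrite graded_jacobson_radical0 => _ -> M _ x; rewrite ract0r.
Qed.
End GradedJacobson.

(** * The grading of the Leavitt path algebra *)

Section LpaGrading.
Variables (K : fieldType) (G : ultragraph).
Local Notation L := (lpa K G).
Local Notation s := (@lpa_s K G).
Local Notation s' := (@lpa_sstar K G).
Local Notation p := (@lpa_p K G).
Local Notation V := (fspan s s' p).
Local Notation cls := (pclass (@lpa_rel K G)).

Lemma pclassM t u : cls t ** cls u = cls (TMul t u). Proof. exact: pmulE. Qed.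
Lemma pclassD t u : cls t + cls u = cls (TAdd t u). Proof. exact: paddE. Qed.
Lemma pclassN t : - cls t = cls (TOpp t). Proof. exact: poppE. Qed.
Lemma pclassZ k t : k *: cls t = cls (TScale k t). Proof. exact: pscaleE. Qed.
Lemma pclass_rel t u : lpa_rel t u -> cls t = cls u.
Proof. by move=> tu; apply/pclassP; exact: NCrel. Qed.

Lemma lpa_family : leavitt_family s s' p.
Proof.
split; intros; rewrite ?pclassM;
  by first [apply: pclass_rel; constructor | exact: pclass_rel (rel_p0 K G)].
Qed.

Lemma lpa_pU A B : p (gvU A B) = p A + p B - p (gvI A B).
Proof. by rewrite [LHS](pclass_rel (rel_pU K A B)) -!pclassD -pclassN. Qed.

Lemma lpa_regular_vertex v (l : seq (edge G)) : l <> [::] -> uniq l ->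
  (forall e, (e \in l) = (esource e == v)) -> p (gv1 v) = \sum_(e <- l) s e ** s' e.
Proof.
move=> l0 ul lv; rewrite [LHS](pclass_rel (rel_regular K l0 ul lv)).
under [RHS]eq_bigr do rewrite pclassM.
by apply: (@big_morph _ _ cls 0 +%R TZero TAdd) => // t u; rewrite pclassD.
Qed.

(* The generators act on sequences [int -> L] with the shift recording the
   degree; this separates the homogeneous components. *)
Fixpoint shift_eval (t : nuterm K (lpa_gen G)) (f : int -> L) : int -> L :=
  match t with
  | TGen (GenS e) => fun n => s e ** f (n - 1)
  | TGen (GenSstar e) => fun n => s' e ** f (n + 1)
  | TGen (GenP A) => fun n => p A ** f n
  | TZero => fun=> 0
  | TOpp t => fun n => - shift_eval t f n
  | TAdd t u => fun n => shift_eval t f n + shift_eval u f n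
  | TScale k t => fun n => k *: shift_eval t f n
  | TMul t u => shift_eval t (shift_eval u f)
  end.

Lemma shift_evalD t f g :
  shift_eval t (fun n => f n + g n) = fun n => shift_eval t f n + shift_eval t g n.
Proof.
elim: t f g => [[e|e|B]||t ht|t ht u hu|k t ht|t ht u hu] f g /=; apply/funext => n.
- by rewrite numulDr.
- by rewrite numulDr.
- by rewrite numulDr.
- by rewrite addr0.
- by rewrite ht opprD.
- by rewrite ht hu addrACA.
- by rewrite ht scalerDr.
- by rewrite hu ht.
Qed.

Lemma shift_evalZ k t f : shift_eval t (fun n => k *: f n) = fun n => k *: shift_eval t f n.
Proof.
elim: t f => [[e|e|B]||t ht|t ht u hu|l t ht|t ht u hu] f /=; apply/funext => n.
- by rewrite -nuscalerAr.
- by rewrite -nuscalerAr.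
- by rewrite -nuscalerAr.
- by rewrite scaler0.
- by rewrite ht scalerN.
- by rewrite ht hu scalerDr.
- by rewrite ht !scalerA mulrC.
- by rewrite hu ht.
Qed.

(** Every defining relation is homogeneous, so both sides carry the same shift and the identity
    reduces to the relation in [lpa]. *)
Lemma shift_eval_rel t u f n : lpa_rel t u -> shift_eval t f n = shift_eval u f n.
Proof.
have lf := lpa_family; case=> {t u} /=.
- by rewrite (lf_p0 lf) nu0r.
- by move=> B C; rewrite numulA (lf_pI lf).
- by move=> B C; rewrite lpa_pU nuBl numulDl.
- by move=> e; rewrite numulA (lf_ps lf).
- by move=> e; rewrite numulA (lf_sp lf).
- by move=> e; rewrite numulA (lf_ps' lf).
- by move=> e; rewrite numulA (lf_s'p lf).
- by move=> e; rewrite addrK numulA (lf_s's lf).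
- by move=> e g eg; rewrite numulA (lf_s's0 lf eg) nu0r.
- move=> v l l0 ul lv; rewrite (lpa_regular_vertex l0 ul lv) nu_suml.
  elim: l {l0 ul lv} => [|e l IH]; first by rewrite !big_nil.
  by rewrite !big_cons /= IH subrK numulA.
Qed.

Lemma shift_eval_cong t u : nucong (@lpa_rel K G) t u -> shift_eval t = shift_eval u.
Proof.
elim=> {t u} /=.
- by move=> t u tu; apply/funext => f; apply/funext => n; exact: shift_eval_rel.
- by [].
- by move=> t u _ ->.
- by move=> t u v _ -> _ ->.
- by move=> t t' _ ->.
- by move=> t t' u u' _ -> _ ->.
- by move=> k t t' _ ->.
- by move=> t t' u u' _ -> _ ->.
- by move=> t u v; apply/funext => f; apply/funext => n; rewrite addrA.
- by move=> t u; apply/funext => f; apply/funext => n; rewrite addrC.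
- by move=> t; apply/funext => f; apply/funext => n; rewrite add0r.
- by move=> t; apply/funext => f; apply/funext => n; rewrite addNr.
- by move=> k l t; apply/funext => f; apply/funext => n; rewrite scalerA.
- by move=> t; apply/funext => f; apply/funext => n; rewrite scale1r.
- by move=> k t u; apply/funext => f; apply/funext => n; rewrite scalerDr.
- by move=> k l t; apply/funext => f; apply/funext => n; rewrite scalerDl.
- by [].
- by [].
- by move=> t u v; apply/funext => f; rewrite shift_evalD.
- by [].
- by move=> k t u; apply/funext => f; rewrite shift_evalZ.
Qed.

Definition shift_act (x : L) : (int -> L) -> int -> L := shift_eval (prep x).

Lemma shift_act_cls t : shift_act (cls t) = shift_eval t.
Proof. exact/shift_eval_cong/pclassK. Qed.

Lemma shift_actD x y f n : shift_act (x + y) f n = shift_act x f n + shift_act y f n.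
Proof. by rewrite -(prepK x) -(prepK y) pclassD !shift_act_cls. Qed.
Lemma shift_act0 f n : shift_act 0 f n = 0.
Proof. by rewrite (shift_act_cls TZero). Qed.
Lemma shift_actZ k x f n : shift_act (k *: x) f n = k *: shift_act x f n.
Proof. by rewrite -(prepK x) pclassZ !shift_act_cls. Qed.
Lemma shift_actM x y f : shift_act (x ** y) f = shift_act x (shift_act y f).
Proof. by rewrite -(prepK x) -(prepK y) pclassM !shift_act_cls. Qed.

Lemma shift_act_fspan m k x f n : V m k x ->
  shift_act x f n = x ** f (n - (m%:Z - k%:Z)).
Proof.
move=> hx; elim: hx f n => {m k x}.
- by move=> m k f n; rewrite shift_act0 nu0r.
- by move=> m k x y _ hx _ hy f n; rewrite shift_actD hx hy numulDl.
- by move=> m k c x _ hx f n; rewrite shift_actZ hx -nuscalerAl.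
- by move=> m B f n; rewrite shift_act_cls /= subrr subr0.
- move=> m k e x _ hx f n; rewrite shift_actM shift_act_cls /= hx numulA.
  by congr (_ ** f _); lia.
- move=> m k e x _ hx f n; rewrite shift_actM hx shift_act_cls /= numulA.
  by congr (_ ** f _); lia.
Qed.

(** A union that is directed by widening, hence a subgroup; it is the form of [lpa_component] in
    which products and regularity are accessible. *)
Definition homog_span (n : int) (x : L) : Prop :=
  exists m k, m%:Z - k%:Z = n /\ V m k x.

Lemma homog_span_common n x y : homog_span n x -> homog_span n y ->
  exists m k, [/\ m%:Z - k%:Z = n, V m k x & V m k y].
Proof.
move=> [m [k [mk hx]]] [m' [k' [mk' hy]]].
exists (k' + m)%N, (k' + k)%N; split; first by lia.
  exact: fspan_widenD.
have -> : (k' + m = k + m')%N by lia.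
by rewrite [(k' + k)%N]addnC; exact: fspan_widenD.
Qed.

Lemma homog_span_subgroup n : is_subgroup (homog_span n).
Proof.
split=> [|x y hx hy].
  by case: n => n; [exists n, 0%N | exists 0%N, n.+1]; split; try exact: fspan0; lia.
have [m [k [mk {}hx {}hy]]] := homog_span_common hx hy.
by exists m, k; split=> //; exact: (subgroupB (fspan_subgroup _ _ _ _ _)).
Qed.

Lemma homog_spanM m n x y : homog_span m x -> homog_span n y -> homog_span (m + n) (x ** y).
Proof.
move=> [a [b [ab hx]]] [c [d [cd hy]]]; exists (c + a)%N, (b + d)%N; split; first by lia.
apply: (fspan_mul lpa_family (fspan_widenD c hx)).
by rewrite addnC; exact: fspan_widenD.
Qed.

Lemma homog_spanZ n k x : homog_span n x -> homog_span n (k *: x).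
Proof. by move=> [a [b [ab hx]]]; exists a, b; split=> //; exact: fspanZ. Qed.

Lemma homog_span_regular n x : homog_span n x -> regular_in (homog_span (- n)) x.
Proof.
move=> [m [k [<- hx]]]; have [y hy xE] := fspan_regular lpa_family hx.
by exists y => //; exists k, m; split=> //; rewrite opprB.
Qed.

Lemma s_edges_span e l : V (size l).+1 0 (s_edges K e l).
Proof.
elim: l e => [|f l IH] e /=; last exact: fspan_s.
by rewrite -(lf_sp lpa_family); apply: fspan_s; exact: fspan_p.
Qed.

Lemma sstar_edges_span e l : V 0 (size l).+1 (sstar_edges K e l).
Proof.
elim: l e => [|f l IH] e /=; last exact: fspan_s'.
by rewrite -(lf_ps' lpa_family); apply: fspan_s'; exact: fspan_p.
Qed.

Lemma lpa_spanning_homog n x : lpa_spanning n x -> homog_span n x.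
Proof.
move=> [a [b [B [ab ->]]]]; exists (plength a), (plength b); split=> //.
apply: (fspan_mul lpa_family (k := 0)); first apply: (fspan_mul lpa_family (k := 0)).
- by case: a {ab} => [C|e l ?]; [exact: fspan_p | exact: s_edges_span].
- exact: fspan_p.
- by case: b {ab} => [C|e l ?]; [exact: fspan_p | exact: sstar_edges_span].
Qed.

Lemma lpa_component_homog n x : lpa_component n x -> homog_span n x.
Proof.
move=> [l [hl ->]]; apply: (subgroup_sum (homog_span_subgroup n)) => c cl.
by apply: homog_spanZ; apply: lpa_spanning_homog; exact: hl.
Qed.

Lemma lpa_component0 n : lpa_component n (0 : L).
Proof. by exists [::]; rewrite big_nil. Qed.

Lemma lpa_componentD n (x y : L) :
  lpa_component n x -> lpa_component n y -> lpa_component n (x + y).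
Proof.
move=> [l [hl ->]] [l' [hl' ->]]; exists (l ++ l'); rewrite big_cat; split=> // c.
by rewrite mem_cat => /orP[/hl|/hl'].
Qed.

Lemma lpa_componentZ n k (x : L) : lpa_component n x -> lpa_component n (k *: x).
Proof.
move=> [l [hl ->]]; exists [seq (k * c.1, c.2) | c <- l]; split.
  by move=> _ /mapP[c cl ->]; exact: (hl c cl).
by rewrite big_map scaler_sumr; apply: eq_bigr => c _; rewrite scalerA.
Qed.

Lemma lpa_component_spanning n (x : L) : lpa_spanning n x -> lpa_component n x.
Proof.
move=> hx; exists [:: (1, x)]; rewrite big_seq1 scale1r; split=> // c.
by rewrite inE => /eqP ->.
Qed.

Lemma lpa_p_disjoint (e f : edge G) : ~ erange e (esource f) ->
  p (gvrange e) ** p (gv1 (esource f)) = 0.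
Proof.
move=> ef; rewrite (lf_pI lpa_family) (_ : gvI _ _ = gv0 G) ?(lf_p0 lpa_family) //.
by apply: gvset_eq; apply/seteqP; split=> v //= [rv vf]; apply: ef; rewrite -vf.
Qed.

Lemma s_edges_source f l : p (gv1 (esource f)) ** s_edges K f l = s_edges K f l.
Proof. by case: l => [|g l] /=; rewrite ?numulA (lf_ps lpa_family). Qed.

Lemma sstar_edges_source f l : sstar_edges K f l ** p (gv1 (esource f)) = sstar_edges K f l.
Proof. by case: l => [|g l] /=; rewrite -?numulA (lf_s'p lpa_family). Qed.

(** Prepending e to a path gives a path when the source of its first edge lies in r(e), and the
    product is 0 otherwise. A path of length 0 becomes e alone, its set being absorbed into the
    middle projection. *)
Lemma lpa_spanning_s n e (x : L) : lpa_spanning n x -> lpa_component (n + 1) (s e ** x).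
Proof.
move=> [a [b [B [ab ->]]]]; case: a ab => [C|f l fl] ab; rewrite !numulA.
  apply: lpa_component_spanning; exists (PEdges (e := e) (l := [::]) I), b, (gvI C B).
  split; first by rewrite /= in ab *; lia.
  by rewrite /= -[s e ** p C ** _]numulA (lf_pI lpa_family).
have [ef|ef] := pselect (erange e (esource f)).
  apply: lpa_component_spanning; exists (PEdges (e := e) (l := f :: l) (conj ef fl)), b, B.
  by split=> //; rewrite /= in ab *; lia.
rewrite /= -(s_edges_source f l) -(lf_sp lpa_family) numulA -[s e ** _ ** p (gv1 _)]numulA.
by rewrite lpa_p_disjoint // nur0 !nu0r; exact: lpa_component0.
Qed.

Lemma lpa_spanning_s' n e (x : L) : lpa_spanning n x -> lpa_component (n - 1) (x ** s' e).
Proof.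
move=> [a [b [B [ab ->]]]]; case: b ab => [C|f l fl] ab; rewrite -!numulA.
  apply: lpa_component_spanning; exists a, (PEdges (e := e) (l := [::]) I), (gvI B C).
  split; first by rewrite /= in ab *; lia.
  by rewrite /= [p B ** _]numulA (lf_pI lpa_family) numulA.
have [ef|ef] := pselect (erange e (esource f)).
  apply: lpa_component_spanning; exists a, (PEdges (e := e) (l := f :: l) (conj ef fl)), B.
  by split; [rewrite /= in ab *; lia | rewrite /= !numulA].
rewrite /= -(sstar_edges_source f l) -(lf_ps' lpa_family) -numulA [p (gv1 _) ** _]numulA.
rewrite (leavitt_family_comm _ _ lpa_family) lpa_p_disjoint // nu0r !nur0.
exact: lpa_component0.
Qed.

Lemma lpa_component_s n e (x : L) : lpa_component n x -> lpa_component (n + 1) (s e ** x).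
Proof.
move=> [l [hl ->]]; rewrite nu_sumr; elim: l hl => [|c l IH] hl.
  by rewrite big_nil; exact: lpa_component0.
rewrite big_cons; apply: lpa_componentD; last by apply: IH => d dl; apply: hl; rewrite inE dl orbT.
rewrite -nuscalerAr; apply: lpa_componentZ; apply: lpa_spanning_s; apply: hl; exact: mem_head.
Qed.

Lemma lpa_component_s' n e (x : L) : lpa_component n x -> lpa_component (n - 1) (x ** s' e).
Proof.
move=> [l [hl ->]]; rewrite nu_suml; elim: l hl => [|c l IH] hl.
  by rewrite big_nil; exact: lpa_component0.
rewrite big_cons; apply: lpa_componentD; last by apply: IH => d dl; apply: hl; rewrite inE dl orbT.
rewrite -nuscalerAl; apply: lpa_componentZ; apply: lpa_spanning_s'; apply: hl; exact: mem_head.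
Qed.

Lemma lpa_componentE : @lpa_component K G = homog_span.
Proof.
apply/funext => n; apply/seteqP; split=> x; first exact: lpa_component_homog.
move=> [m [k [<- hx]]]; elim: hx => {m k x n}.
- by move=> m k; exact: lpa_component0.
- by move=> m k x y _ hx _ hy; exact: lpa_componentD.
- by move=> m k c x _ hx; exact: lpa_componentZ.
- move=> n B; apply: lpa_component_spanning; exists (PSet B), (PSet B), B.
  by rewrite !subrr; split=> //=; rewrite !(family_p_sub lpa_family).
- move=> m k e x _ hx; have := lpa_component_s e hx; congr lpa_component; lia.
- move=> m k e x _ hx; have := lpa_component_s' e hx; congr lpa_component; lia.
Qed.

Lemma lpa_homogeneous_sum (x : L) : exists l : seq (int * L),
  (forall c, c \in l -> homog_span c.1 c.2) /\ x = \sum_(c <- l) c.2.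
Proof.
rewrite -(prepK x); elim: (prep x) => {x} [g||t [l [hl tE]]|t [l [hl tE]] u [l' [hl' uE]]|
  k t [l [hl tE]]|t [l [hl tE]] u [l' [hl' uE]]].
- suff [n hn] : exists n, homog_span n (cls (TGen g)).
    exists [:: (n, cls (TGen g))]; rewrite big_seq1; split=> // c.
    by rewrite inE => /eqP ->.
  case: g => [e|e|B].
  + exists 1, 1%N, 0%N; split=> //; rewrite -/(s e) -(lf_sp lpa_family).
    by apply: fspan_s; exact: fspan_p.
  + exists (- 1), 0%N, 1%N; split=> //; rewrite -/(s' e) -(lf_ps' lpa_family).
    by apply: fspan_s'; exact: fspan_p.
  + by exists 0, 0%N, 0%N; split=> //; exact: fspan_p.
- by exists [::]; rewrite big_nil.
- exists [seq (c.1, - c.2) | c <- l]; rewrite -pclassN tE big_map sumrN; split=> //.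
  by move=> _ /mapP[c cl ->]; apply: (subgroupN (homog_span_subgroup _)); exact: (hl c cl).
- exists (l ++ l'); rewrite -pclassD tE uE big_cat; split=> // c.
  by rewrite mem_cat => /orP[/hl|/hl'].
- exists [seq (c.1, k *: c.2) | c <- l]; rewrite -pclassZ tE big_map scaler_sumr; split=> //.
  by move=> _ /mapP[c cl ->]; apply: homog_spanZ; exact: (hl c cl).
- exists [seq (c.1 + d.1, c.2 ** d.2) | c <- l, d <- l']; split.
    by move=> _ /allpairsP[[c d] [cl dl ->]]; apply: homog_spanM;
      [exact: (hl c cl)|exact: (hl' d dl)].
  rewrite -pclassM tE uE big_allpairs_dep nu_suml; apply: eq_bigr => c _.
  by rewrite nu_sumr.
Qed.

Lemma lpa_is_direct_sum : is_direct_sum homog_span.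
Proof.
split; first exact: homog_span_subgroup.
- move=> x; have [l [hl ->]] := lpa_homogeneous_sum x.
  exists (undup [seq c.1 | c <- l]), (fun n => \sum_(c <- l) if c.1 == n then c.2 else 0); split.
    move=> n; apply: (subgroup_sum (homog_span_subgroup n)) => c cl.
    case: eqP => [<-|_]; first exact: hl.
    exact: (subgroup0 (homog_span_subgroup n)).
  rewrite exchange_big /=; apply: eq_big_seq => c cl.
  rewrite (bigD1_seq c.1) ?undup_uniq ?mem_undup ?map_f //= eqxx big1 ?addr0 // => n.
  by rewrite eq_sym => /negPf ->.
- move=> r c ur hc c0 n nr; have [m [k [mk hn]]] := hc n.
  have [B cB] := fspan_lunit (leavitt_family_op lpa_family) (fspan_op hn).
  (* B is chosen so that c_n p_B = c_n. Each c_j moves this sequence, concentrated in degree 0, to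
     degree j, so evaluating at n reads off c_n alone. *)
  pose f (j : int) := if j == 0 then p B else 0.
  have act j : shift_act (c j) f n = if j == n then c n else 0.
    have [m' [k' [mk' hj]]] := hc j; rewrite (shift_act_fspan _ _ hj) mk' /f subr_eq0 eq_sym.
    by case: eqP => [->|_]; [exact: cB | exact: nur0].
  have := shift_act0 f n; rewrite -c0.
  rewrite (big_morph (fun x => shift_act x f n) (fun x y => shift_actD x y f n) (shift_act0 f n)).
  under eq_bigr do rewrite act.
  rewrite (bigD1_seq n) //= eqxx big1 ?addr0 // => j /negPf ->; exact.
Qed.

Lemma lpa_is_graded : is_graded_ring (@lpa_component K G).
Proof. by rewrite lpa_componentE; split; [exact: lpa_is_direct_sum | exact: homog_spanM]. Qed.

Lemma lpa_regular n x : lpa_component n x -> regular_in (lpa_component (- n)) (x : L).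
Proof. by rewrite lpa_componentE; exact: homog_span_regular. Qed.

End LpaGrading.

Unset Implicit Arguments.

Theorem theorem4p9 (K : fieldType) (G : ultragraph) (hG : no_sinks G) :
  graded_von_neumann_regular (@lpa_component K G) /\
  (* (1) *)
  ((forall I : set (lpa K G),
      graded_right_ideal (@lpa_component K G) I ->
      (exists l : seq (lpa K G), I = right_ideal_gen [set` l]) ->
      exists e : lpa K G,
        [/\ homogeneous (@lpa_component K G) e, idempotent_elt e
          & I = right_ideal_gen [set e]]) /\
   (forall I : set (lpa K G),
      graded_left_ideal (@lpa_component K G) I ->
      (exists l : seq (lpa K G), I = left_ideal_gen [set` l]) ->
      exists e : lpa K G,
        [/\ homogeneous (@lpa_component K G) e, idempotent_elt e
          & I = left_ideal_gen [set e]])) /\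
  (* (2) *)
  ((forall I : set (lpa K G),
      graded_right_ideal (@lpa_component K G) I -> idempotent_ideal I) /\
   (forall I : set (lpa K G),
      graded_left_ideal (@lpa_component K G) I -> idempotent_ideal I)) /\
  (* (3) *)
  (forall I : set (lpa K G),
      graded_ideal (@lpa_component K G) I ->
      graded_semiprime (@lpa_component K G) I) /\
  (* (4) *)
  ((forall (M : rmodule (lpa K G)) (M_ : int -> set M),
      is_rmodule_grading (@lpa_component K G) M_ -> flat_rmodule M) /\
   (forall (M : lmodule (lpa K G)) (M_ : int -> set M),
      is_lmodule_grading (@lpa_component K G) M_ -> flat_lmodule M)) /\
  (* (5) *)
  (jacobson_radical (lpa K G) = graded_jacobson_radical (@lpa_component K G) /\
   graded_jacobson_radical (@lpa_component K G) = [set 0]).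
Proof.
have gL := @lpa_is_graded K G; have regL := @lpa_regular K G.
split; first by split=> // x [n /regL[y _ xE]]; exists y.
split; first split.
- exact: graded_right_ideal_principal.
- exact: graded_left_ideal_principal.
split; first split.
- exact: graded_right_ideal_idempotent.
- exact: graded_left_ideal_idempotent.
split; first exact: graded_ideal_semiprime.
split; last exact: jacobson_radicals.
split; first exact: graded_rmodule_flat.
exact: graded_lmodule_flat.
Qed.
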